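(* Let $d_A,d_B,\ell\ge1$ be integers, $\mathcal{H}_A=\mathbb{C}^{d_A}$, $\mathcal{H}_B=\mathbb{C}^{d_B}$, and let $\mathcal{SEP}$, $\mathcal{DPS}_\ell$, $\mathcal{EXT}_\ell$ be the cones of separable states, of states in the $\ell$-th level of the DPS hierarchy, and of $\ell$-extendible states (without partial transpose conditions) on $\mathcal{H}_A\otimes\mathcal{H}_B$. For $M\in\mathrm{Herm}(d_Ad_B)$ let $p_M$ be its associated Hermitian polynomial. Then: (i) $\mathcal{SEP}^*=\{M\in\mathrm{Herm}(d_Ad_B): p_M\text{ is nonnegative}\}$; (ii) $\mathcal{DPS}_\ell^*=\{M\in\mathrm{Herm}(d_Ad_B):\|y\|^{2(\ell-1)}p_M\text{ is rsos}\}$; (iii) $\mathcal{EXT}_\ell^*=\{M\in\mathrm{Herm}(d_Ad_B):\|y\|^{2(\ell-1)}p_M\text{ is csos}\}$.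
   Context: $\mathrm{Herm}(m)$ is the real vector space of $m\times m$ Hermitian matrices. For a convex cone $K\subset\mathrm{Herm}(m)$, $K^*=\{M\in\mathrm{Herm}(m):\mathrm{Tr}[M\rho]\ge0\ \forall\rho\in K\}$. For $M\in\mathrm{Herm}(d_Ad_B)$, $p_M(x,\bar x,y,\bar y)=\sum_{ijkl}M_{ij,kl}\,x_i\bar x_ky_j\bar y_l$ for $x\in\mathbb{C}^{d_A}$, $y\in\mathbb{C}^{d_B}$ (indices $i,k$ refer to $\mathcal{H}_A$, $j,l$ to $\mathcal{H}_B$), and $\|y\|^2=\sum_jy_j\bar y_j$. A Hermitian polynomial is a polynomial with complex coefficients in complex variables $z$ and their conjugates $\bar z$ that takes only real values (here $z=(x,y)$). It is nonnegative if its values are $\ge0$ for all $z$. It is rsos (real sum-of-squares) if it is a finite sum $\sum_ig_i(z,\bar z)^2$ with $g_i$ Hermitian polynomials. It is csos (complex sum-of-squares) if it is a finite sum $\sum_i|q_i(z)|^2$ with $q_i$ complex polynomials in $z$ alone (not $\bar z$). $\mathcal{SEP}$ is the set of finite sums $\sum_ip_i\,x_ix_i^\dagger\otimes y_iy_i^\dagger$ with $p_i\ge0$, $x_i\in\mathcal{H}_A$, $y_i\in\mathcal{H}_B$. Let $\mathcal{H}_{B_1},\ldots,\mathcal{H}_{B_\ell}$ be copies of $\mathcal{H}_B$. For a positive semidefinite $\rho$ on $\mathcal{H}_A\otimes\mathcal{H}_B$, consider positive semidefinite operators $\rho_{AB_{[\ell]}}$ on $\mathcal{H}_A\otimes\mathcal{H}_{B_1}\otimes\cdots\otimes\mathcal{H}_{B_\ell}$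 and the conditions: (1) the partial trace of $\rho_{AB_{[\ell]}}$ over $B_2,\ldots,B_\ell$ equals $\rho$; (2) $(I\otimes\Pi)\rho_{AB_{[\ell]}}(I\otimes\Pi)=\rho_{AB_{[\ell]}}$, where $\Pi$ is the orthogonal projector of $\mathcal{H}_B^{\otimes\ell}$ onto its symmetric subspace (vectors invariant under all permutations of the $\ell$ tensor factors); (3) for each $s=1,\ldots,\ell$, the partial transpose of $\rho_{AB_{[\ell]}}$ on the systems $B_1,\ldots,B_s$ is positive semidefinite. Then $\mathcal{DPS}_\ell$ is the set of $\rho\ge 0$ for which some $\rho_{AB_{[\ell]}}\ge0$ satisfies (1), (2), (3), and $\mathcal{EXT}_\ell$ the set of $\rho\ge0$ for which some $\rho_{AB_{[\ell]}}\ge0$ satisfies (1) and (2). *)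

(* Defs.v *)
From HB Require Import structures.
From mathcomp Require Import all_boot all_order all_algebra all_fingroup.
From mathcomp Require Import sesquilinear spectral.
From mathcomp Require Import classical_sets reals complex mxtens mpoly.

Set Implicit Arguments.
Unset Strict Implicit.
Unset Printing Implicit Defensive.

Import Order.TTheory GRing.Theory Num.Theory.
Local Open Scope ring_scope.
Local Open Scope classical_set_scope.
Local Open Scope sesquilinear_scope.

(* Over a numClosedFieldType, [0 <= z] means that z is real and nonnegative. *)
Definition psdmx {C : numClosedFieldType} {m : nat} (A : 'M[C]_m) : Prop :=
  A \is hermsymmx /\ forall v : 'cV[C]_m, 0 <= (v^t* *m A *m v) 0 0.

Definition dual_cone {C : numClosedFieldType} {m : nat} (K : set 'M[C]_m) :
  set 'M[C]_m :=
  [set M | M \is hermsymmx /\ forall rho, K rho -> 0 <= \tr (M *m rho)].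

(* The space H_A (x) H_B is C^(dA * dB), with the basis vector e_i (x) e_j in
   position [mxtens_index (i, j)], as for the Kronecker product [*t]. *)
Definition SEP (C : numClosedFieldType) (dA dB : nat) : set 'M[C]_(dA * dB) :=
  [set rho | exists (n : nat) (p : 'I_n -> C)
                    (x : 'I_n -> 'cV[C]_dA) (y : 'I_n -> 'cV[C]_dB),
     (forall i, 0 <= p i) /\
     rho = \sum_i p i *: ((x i *m (x i)^t*) *t (y i *m (y i)^t*))].
Arguments SEP : clear implicits.

(* The standard basis of H_B^(x)l is indexed by the words b : 'I_l -> 'I_dB; the
   factor B_(m+1) corresponds to the ordinal m. *)
Notation word l dB := {ffun 'I_l -> 'I_dB}.

Definition ext_index {dA dB l : nat} (i : 'I_dA) (b : word l dB) :
  'I_(dA * #|{: word l dB}|) := mxtens_index (i, enum_rank b).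

(* Matrix, acting on row vectors, of the permutation s of the l tensor
   factors: e_b is sent to e_(b o s). *)
Definition factor_perm_mx (C : numClosedFieldType) (dB l : nat) (s : 'S_l) :
  'M[C]_#|{: word l dB}| :=
  \matrix_(u, v) let b : word l dB := enum_val u in
                 (enum_val v == [ffun m => b (s m)])%:R.

(* Row space of the vectors fixed by all permutations of the factors. *)
Definition sym_subspace (C : numClosedFieldType) (dB l : nat) :
  'M[C]_#|{: word l dB}| :=
  (\bigcap_(s : 'S_l) eigenspace (factor_perm_mx C dB s) 1)%MS.

(* [proj_ortho] acts on row vectors; [sym_projP] below shows that the choice of
   rows or columns is immaterial. *)
Definition sym_proj (C : numClosedFieldType) (dB l : nat) :
  'M[C]_#|{: word l dB}| := proj_ortho (sym_subspace C dB l).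

(* Partial trace over B_2, ..., B_l: the words b, c start with the letters
   j, k and coincide from the second letter on. *)
Definition ptrace_tail {C : numClosedFieldType} {dA dB l : nat}
  (rho : 'M[C]_(dA * #|{: word l dB}|)) : 'M[C]_(dA * dB) :=
  \matrix_(u, v)
    let (i, j) := mxtens_unindex u in
    let (i', k) := mxtens_unindex v in
    \sum_(b : word l dB)
    \sum_(c : word l dB |
           [forall m : 'I_l, if val m == 0%N then (b m == j) && (c m == k)
                             else b m == c m])
      rho (ext_index i b) (ext_index i' c).

Definition first_from {dB l : nat} (s : nat) (c b : word l dB) : word l dB :=
  [ffun m : 'I_l => if (m < s)%N then c m else b m].

(* Partial transpose on B_1, ..., B_s: the first s letters of the row and column
   words are exchanged. *)
Definition ptranspose {C : numClosedFieldType} {dA dB l : nat} (s : nat)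
  (rho : 'M[C]_(dA * #|{: word l dB}|)) : 'M[C]_(dA * #|{: word l dB}|) :=
  \matrix_(u, v)
    let (i, e) := mxtens_unindex u in
    let (k, f) := mxtens_unindex v in
    let b : word l dB := enum_val e in
    let c : word l dB := enum_val f in
    rho (ext_index i (first_from s c b)) (ext_index k (first_from s b c)).

Definition is_sym_extension {C : numClosedFieldType} {dA dB l : nat}
  (rho : 'M[C]_(dA * dB)) (sigma : 'M[C]_(dA * #|{: word l dB}|)) : Prop :=
  [/\ psdmx sigma,
      ptrace_tail sigma = rho &
      (1%:M *t sym_proj C dB l) *m sigma *m (1%:M *t sym_proj C dB l) = sigma].

Definition EXT (C : numClosedFieldType) (dA dB l : nat) :
  set 'M[C]_(dA * dB) :=
  [set rho | psdmx rho /\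
     exists sigma : 'M[C]_(dA * #|{: word l dB}|), is_sym_extension rho sigma].
Arguments EXT : clear implicits.

Definition DPS (C : numClosedFieldType) (dA dB l : nat) :
  set 'M[C]_(dA * dB) :=
  [set rho | psdmx rho /\
     exists sigma : 'M[C]_(dA * #|{: word l dB}|),
       is_sym_extension rho sigma /\
       forall s : nat, (1 <= s <= l)%N -> psdmx (ptranspose s sigma)].
Arguments DPS : clear implicits.

(* A polynomial in z, zbar (z in C^n) is an element of {mpoly C[n + n]}, whose
   first n variables stand for z and last n variables for zbar; [heval P z] is
   the value P(z, zbar). *)
Definition heval {C : numClosedFieldType} {n : nat} (P : {mpoly C[n + n]})
  (z : 'cV[C]_n) : C := P.@[fun t => col_mx z (map_mx Num.conj z) t 0].

Definition hermitian_poly {C : numClosedFieldType} {n : nat}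
  (P : {mpoly C[n + n]}) : Prop := forall z, heval P z \is Num.real.

Definition nonneg_poly {C : numClosedFieldType} {n : nat}
  (P : {mpoly C[n + n]}) : Prop := forall z, 0 <= heval P z.

Definition rsos {C : numClosedFieldType} {n : nat} (P : {mpoly C[n + n]}) :
  Prop :=
  exists gs : seq {mpoly C[n + n]},
    (forall g, g \in gs -> hermitian_poly g) /\
    forall z, heval P z = \sum_(g <- gs) heval g z ^+ 2.

Definition csos {C : numClosedFieldType} {n : nat} (P : {mpoly C[n + n]}) :
  Prop :=
  exists qs : seq {mpoly C[n]},
    forall z : 'cV[C]_n,
      heval P z = \sum_(q <- qs) `|q.@[fun t => z t 0]| ^+ 2.

Section Variables_xy.
Context {C : numClosedFieldType} {dA dB : nat}.

(* Here z = (x, y). *)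
Definition Xx (i : 'I_dA) : {mpoly C[(dA + dB) + (dA + dB)]} :=
  'X_(lshift (dA + dB) (lshift dB i)).
Definition Xy (j : 'I_dB) : {mpoly C[(dA + dB) + (dA + dB)]} :=
  'X_(lshift (dA + dB) (rshift dA j)).
Definition Xxbar (i : 'I_dA) : {mpoly C[(dA + dB) + (dA + dB)]} :=
  'X_(rshift (dA + dB) (lshift dB i)).
Definition Xybar (j : 'I_dB) : {mpoly C[(dA + dB) + (dA + dB)]} :=
  'X_(rshift (dA + dB) (rshift dA j)).

End Variables_xy.

Definition assoc_poly {C : numClosedFieldType} {dA dB : nat}
  (M : 'M[C]_(dA * dB)) : {mpoly C[(dA + dB) + (dA + dB)]} :=
  \sum_(i < dA) \sum_(j < dB) \sum_(k < dA) \sum_(l < dB)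
    M (mxtens_index (i, j)) (mxtens_index (k, l))
      *: (Xx i * Xxbar k * Xy j * Xybar l).

Definition normsq_y (C : numClosedFieldType) (dA dB : nat) :
  {mpoly C[(dA + dB) + (dA + dB)]} := \sum_(j < dB) Xy j * Xybar j.

Lemma heval_assoc_poly (C : numClosedFieldType) (dA dB : nat)
  (M : 'M[C]_(dA * dB)) (x : 'cV[C]_dA) (y : 'cV[C]_dB) :
  heval (assoc_poly M) (col_mx x y) =
  \sum_(i < dA) \sum_(j < dB) \sum_(k < dA) \sum_(l < dB)
    M (mxtens_index (i, j)) (mxtens_index (k, l))
      * (x i 0 * (x k 0)^* * y j 0 * (y l 0)^*).
Proof.
rewrite /heval /assoc_poly raddf_sum; apply: eq_bigr => i _.
rewrite raddf_sum; apply: eq_bigr => j _.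
rewrite raddf_sum; apply: eq_bigr => k _.
rewrite raddf_sum; apply: eq_bigr => l _ /=.
rewrite mevalZ !mevalM !mevalXU.
by rewrite !(col_mxEu, col_mxEd) ![map_mx _ _ _ _]mxE !(col_mxEu, col_mxEd).
Qed.

Lemma heval_normsq_y (C : numClosedFieldType) (dA dB : nat)
  (x : 'cV[C]_dA) (y : 'cV[C]_dB) :
  heval (normsq_y C dA dB) (col_mx x y) = \sum_(j < dB) y j 0 * (y j 0)^*.
Proof.
rewrite /heval raddf_sum; apply: eq_bigr => j _ /=.
by rewrite mevalM !mevalXU !(col_mxEu, col_mxEd)
  ![map_mx _ _ _ _]mxE !(col_mxEu, col_mxEd).
Qed.

Lemma sym_subspaceP (C : numClosedFieldType) (dB l : nat)
  (v : 'rV[C]_#|{: word l dB}|) :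
  (v <= sym_subspace C dB l)%MS <->
  forall (s : 'S_l) (b : word l dB),
    v 0 (enum_rank [ffun m => b (s m)]) = v 0 (enum_rank b).
Proof.
have permE (s : 'S_l) (b : word l dB) :
    (v *m factor_perm_mx C dB s) 0 (enum_rank [ffun m => b (s m)])
      = v 0 (enum_rank b).
  rewrite mxE (bigD1 (enum_rank b)) //= big1 ?addr0 => [|u ub].
    rewrite mxE /= !enum_rankK. by rewrite eqxx mulr1.
  rewrite mxE /= enum_rankK; case: eqP => [E|]; last by rewrite mulr0.
  case/eqP: ub; rewrite -[u]enum_valK; congr enum_rank.
  apply/ffunP => m; move/ffunP/(_ ((s^-1)%g m)): E.
  by rewrite !ffunE permKV.
split=> [/sub_bigcapmxP vs s b|vs].
  have /eigenspaceP := vs s isT; rewrite scale1r => vE.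
  by rewrite -[RHS](permE s) vE.
apply/sub_bigcapmxP => s _; apply/eigenspaceP; rewrite scale1r.
apply/rowP => u; rewrite -[u]enum_valK.
have -> : enum_val u =
    [ffun m => [ffun k => (enum_val u : word l dB) ((s^-1)%g k)] (s m)].
  by apply/ffunP => m; rewrite !ffunE permK.
by rewrite permE; apply/esym/vs.
Qed.

Lemma proj_ortho_adj (C : numClosedFieldType) (n : nat) (U : 'M[C]_n) :
  (proj_ortho U)^t* = proj_ortho U.
Proof.
set P := proj_ortho U.
have E : P^t* = P *m P^t*.
  apply/eqP; rewrite -subr_eq0 -[X in X - _]mul1mx -mulmxBl; apply/eqP.
  apply/orthomx1P; rewrite (eqmx_ortho _ (proj_orthoE U)).
  by have := proj_ortho_compl_sub U 1%:M; rewrite mul1mx.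
have {1}-> : P = (P^t*)^t* by rewrite trmxCK.
by rewrite {1}E trmx_mul map_mxM trmxCK -E trmxCK.
Qed.

Lemma sym_projP (C : numClosedFieldType) (dB l : nat) :
  [/\ sym_proj C dB l \is hermsymmx,
      sym_proj C dB l *m sym_proj C dB l = sym_proj C dB l &
      forall v : 'cV[C]_#|{: word l dB}|,
        sym_proj C dB l *m v = v <->
        forall (s : 'S_l) (b : word l dB),
          v (enum_rank [ffun m => b (s m)]) 0 = v (enum_rank b) 0].
Proof.
set P := sym_proj C dB l.
have PP : P *m P = P by exact: proj_ortho_proj.
have PH : P^t* = P by exact: proj_ortho_adj.
split=> // [|v].
  by apply/is_hermitianmxP; rewrite expr0 scale1r PH.
have fixE : P *m v = v <-> (v^t* <= sym_subspace C dB l)%MS.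
  split=> [E|/proj_ortho_id E].
    by rewrite -[v]E trmx_mul map_mxM PH proj_ortho_sub.
  by rewrite -[LHS]trmxCK trmx_mul map_mxM PH E trmxCK.
split=> [/fixE/sym_subspaceP E s b|E].
  by have := E s b; rewrite !mxE => /(inv_inj conjCK).
by apply/fixE/sym_subspaceP => s b; rewrite !mxE E.
Qed.

(* Main.v *)
Require Import Defs.
From HB Require Import structures.
From mathcomp Require Import all_boot all_order all_algebra all_fingroup.
From mathcomp Require Import sesquilinear spectral.
From mathcomp Require Import classical_sets reals complex mxtens mpoly.
From mathcomp Require Import zify ring lra.
From mathcomp Require boolp topology normedtype derive.

Import Order.TTheory GRing.Theory Num.Theory.
Local Open Scope ring_scope.
Local Open Scope classical_set_scope.

(** The three equalities rest on one dictionary.  Let n = dA + dB and z = (x, y).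
    To a linear functional Phi on the polynomials in z and conj z belongs its
    moment matrix sigma, whose entry at ((k, c), (i, b)) is the value of Phi on
    x_i conj(x_k) y^b conj(y)^c, where y^b is the product of the y_j over the
    letters j of the word b of length l.  Under this dictionary
    - the value of Phi at |y|^(2(l-1)) p_M is Tr (M rho), where rho is the partial
      trace of sigma over B_2, ..., B_l ([moment_target]);
    - if h is a combination of the monomials x_i conj(y_(b_1) ... y_(b_s))
      y_(b_(s+1)) ... y_(b_l), then the value of Phi at h conj(h) is the quadratic
      form of the partial transpose of sigma on B_1, ..., B_s
      ([moment_word_poly]).
    Hence the states tested by the dual cone of EXT (resp. DPS) are the functionals
    that are nonnegative on all h conj(h) with s = 0 (resp. with s = 0, ..., l).

    From sums of squares to the dual cone.  A symmetric extension sigma is the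
    moment matrix of a functional that kills every other monomial
    ([moment_functional]); it remains to see that this functional is nonnegative
    on each square.  An identity between values on all z is an identity of
    polynomials ([heval_inj]).  In the csos case the functional sees only the part
    of q spanned by the monomials x_i y^b.  In the rsos case each square g^2 may
    contribute cross terms of unequal degrees, so g is first replaced by its part
    of real degree 1 in x and l in y: the parts of lower degree vanish since their
    squares sum to zero ([homog_sos]).  Such a g is h + conj h with h linear in x
    and free of conj x, and Phi (g^2) = 2 Phi (h conj h) is a sum of quadratic forms
    of partial transposes ([moment_square_ge0]).

    From the dual cone to sums of squares.  The duality statement [sos_duality]
    says that F is a finite sum of squared moduli of functions of a given
    finite-dimensional space as soon as every real combination of point
    evaluations that is nonnegative on those squared moduli is nonnegative on F.
    The moment matrix of a real combination of point evaluations is Hermitian and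
    symmetric for free; if the combination is nonnegative on the relevant
    h conj(h), this matrix is therefore an extension of the kind required in EXT or
    DPS, and M in the dual cone makes the combination nonnegative on
    |y|^(2(l-1)) p_M, as the duality asks ([dual_sos]).  The duality itself is a
    least squares argument: on a finite set of points that spans all evaluations, a
    sum of squares G closest to F exists by compactness, and if G differs from F
    then L = G - F, as a combination of evaluations, satisfies L(F) < 0 and is
    nonnegative on all squares ([sos_duality_fin]).

    Part (i) is the remark that Tr (M rho) is a value of p_M when rho is a product
    state ([SEP_dual]). *)

Set Implicit Arguments.
Unset Strict Implicit.

(** * Duality for sums of squared moduli *)

Section LeastSquares.
Import topology normedtype derive.
Import numFieldNormedType.Exports.

(** The sublevel set of f at 0 is compact, and the minimum over it is a global one. *)
Lemma exists_min (R : realType) (N : nat) (f : 'rV[R]_N -> R) (S : set 'rV[R]_N)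
  (c : R) :
  continuous f -> closed S -> S 0 ->
  (forall q, f q <= f 0 -> forall j, `|q 0 j| <= c) ->
  exists2 q0, S q0 & forall q, S q -> f q0 <= f q.
Proof.
move=> fC Scl S0 fb.
pose A : set 'rV[R]_N := S `&` [set q | f q <= f 0].
have Acl : closed A.
  apply: closedI => //; apply: (@closed_comp _ _ f [set z | z <= f 0]).
    by move=> x _; exact: fC.
  exact: closed_le.
have Ab : bounded_set A.
  exists (Num.max c 0); split; first exact: num_real.
  move=> x cx q [Sq fq]; rewrite /= /Num.Def.normr /= mx_normrE.
  apply: bigmax_le => [|[i j] _] /=.
    by apply: ltW; apply: le_lt_trans cx; rewrite le_max lexx orbT.
  rewrite ord1; apply: (le_trans (fb _ fq j)); apply: ltW; apply: le_lt_trans cx.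
  by rewrite le_max lexx.
have A0 : A 0 by split=> //=.
have [|||q0 q0A q0min] := @EVT_min_rV R N f A.
- by exists 0.
- exact: bounded_closed_compact.
- exact: continuous_subspaceT.
move/set_mem: q0A => [Sq0 fq0]; exists q0 => // q Sq.
case: (leP (f q) (f 0)) => [fq|/ltW fq].
  by apply: q0min; apply/mem_set.
exact: le_trans fq.
Qed.

(** Valued in R rather than in R[i], since the compactness argument below takes
    place over R. *)
Definition sqmod (R : realType) (z : R[i]) : R := complex.Re z ^+ 2 + complex.Im z ^+ 2.

Definition colsq (R : realType) n m (X : 'M[R[i]]_(n, m)) j := \sum_i sqmod (X i j).

Lemma continuous_sumr (R : realType) (T : topologicalType) (I : finType)
  (f : I -> T -> R) :
  (forall i, continuous (f i)) -> continuous (fun x => \sum_i f i x).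
Proof.
move=> fC; apply: continuous_big => //; exact: add_continuous.
Qed.

Lemma continuous_sqr (R : realType) (T : topologicalType) (f : T -> R) :
  continuous f -> continuous (fun x => f x ^+ 2).
Proof. by move=> fC x; apply: continuousM; exact: fC. Qed.

(** A bound on the objective bounds every column sum of squares, hence every entry
    of X, and the constraint is closed.  The matrix X is
    coded by the real vector of the real and imaginary parts of its entries, so
    that compactness of bounded closed sets of real vectors applies. *)
Lemma least_squares (R : realType) n m p (K : 'M[R[i]]_(m, p)) (F : 'I_m -> R) :
  exists2 X0 : 'M[R[i]]_(n, m), X0 *m K = 0 &
    forall X : 'M_(n, m), X *m K = 0 ->
      \sum_j (F j - colsq X0 j) ^+ 2 <= \sum_j (F j - colsq X j) ^+ 2.
Proof.
pose J : finType := (bool * 'I_n * 'I_m)%type.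
pose toX (q : 'rV[R]_#|J|) : 'M[R[i]]_(n, m) := \matrix_(i, j)
  (q 0 (enum_rank ((false, i, j) : J)) +i* q 0 (enum_rank ((true, i, j) : J)))%C.
pose f q := \sum_j (F j - colsq (toX q) j) ^+ 2.
pose S : set 'rV[R]_#|J| := [set q | toX q *m K = 0].
have ReC i j : continuous (fun q => complex.Re (toX q i j)).
  move=> q; rewrite (_ : (fun _ => _) = fun q : 'rV_ _ => q 0 (enum_rank ((false, i, j) : J))).
    exact: coord_continuous.
  by apply/boolp.funext => ?; rewrite mxE.
have ImC i j : continuous (fun q => complex.Im (toX q i j)).
  move=> q; rewrite (_ : (fun _ => _) = fun q : 'rV_ _ => q 0 (enum_rank ((true, i, j) : J))).
    exact: coord_continuous.
  by apply/boolp.funext => ?; rewrite mxE.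
have fC : continuous f.
  apply: continuous_sumr => j; apply: continuous_sqr => q.
  apply: continuousB; first exact: cst_continuous.
  move: q; apply: continuous_sumr => i q.
  apply: (@continuousD _ _ _ (fun q => complex.Re (toX q i j) ^+ 2)
    (fun q => complex.Im (toX q i j) ^+ 2)); apply: continuous_sqr;
    [exact: ReC|exact: ImC].
have Scl : closed S.
  have -> : S = \bigcap_(ik in [set: 'I_n * 'I_p])
     ([set q | (complex.Re ((toX q *m K) ik.1 ik.2) = 0)] `&`
      [set q | (complex.Im ((toX q *m K) ik.1 ik.2) = 0)]).
    apply/seteqP; split=> [q Sq [i k] _ /=|q Sq].
      by have -> : toX q *m K = 0 by []; rewrite mxE.
    apply/matrixP => i k; have [ReE ImE] := Sq (i, k) I; move: ReE ImE => /=.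
    have -> : (0 : 'M[R[i]]_(n, p)) i k = 0 by rewrite mxE.
    by case: ((toX q *m K) i k) => a b /= -> ->.
  apply: closed_bigI => -[i k] _ /=.
  apply: closedI; apply: (@closed_comp _ _ _ [set z | z = 0]) => //=;
    try exact: closed_eq.
  - move=> q _; rewrite (_ : (fun _ => _) = fun q => \sum_j
      (complex.Re (toX q i j) * complex.Re (K j k) - complex.Im (toX q i j) * complex.Im (K j k))).
      move: q; apply: continuous_sumr => j q.
      by apply: (@continuousB _ _ _
        (fun q => complex.Re (toX q i j) * complex.Re (K j k))
        (fun q => complex.Im (toX q i j) * complex.Im (K j k)));
        apply: continuousM; try exact: cst_continuous; [exact: ReC|exact: ImC].
    apply/boolp.funext => q'; rewrite !mxE raddf_sum; apply: eq_bigr => j _.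
    by case: (toX q' i j) (K j k) => [a b] [c d].
  - move=> q _; rewrite (_ : (fun _ => _) = fun q => \sum_j
      (complex.Re (toX q i j) * complex.Im (K j k) + complex.Im (toX q i j) * complex.Re (K j k))).
      move: q; apply: continuous_sumr => j q.
      by apply: (@continuousD _ _ _
        (fun q => complex.Re (toX q i j) * complex.Im (K j k))
        (fun q => complex.Im (toX q i j) * complex.Re (K j k)));
        apply: continuousM; try exact: cst_continuous; [exact: ReC|exact: ImC].
    apply/boolp.funext => q'; rewrite !mxE raddf_sum; apply: eq_bigr => j _.
    by case: (toX q' i j) (K j k) => [a b] [c d].
pose c : R := \sum_j `|F j| + f 0 + 2.
have abs_le_sqr (x : R) : `|x| <= x ^+ 2 + 1.
  by rewrite -(real_normK (num_real x)); have := sqr_ge0 (`|x| - 1); nra.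
have bound q : f q <= f 0 -> forall k, `|q 0 k| <= c.
  move=> fq k; rewrite -[k]enum_valK; case: (enum_val k) => -[e i] j.
  have sq_le : q 0 (enum_rank ((e, i, j) : J)) ^+ 2 <= colsq (toX q) j.
    rewrite /colsq (bigD1 i) //= /sqmod mxE /=.
    have := @sumr_ge0 R _ (index_enum 'I_n) (fun i' => i' != i)
      (fun i' => sqmod (toX q i' j)) (fun i' _ => addr_ge0 (sqr_ge0 _) (sqr_ge0 _)).
    move: (\sum_(_ | _) _) => r; rewrite /sqmod.
    by case: e; move: (sqr_ge0 (q 0 (enum_rank ((false, i, j) : J))))
      (sqr_ge0 (q 0 (enum_rank ((true, i, j) : J)))); lra.
  have F_le : `|F j| <= \sum_j `|F j|.
    by rewrite [leRHS](bigD1 j) //= lerDl sumr_ge0.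
  have d_le : (F j - colsq (toX q) j) ^+ 2 <= f q.
    by rewrite [leRHS](bigD1 j) //= lerDl sumr_ge0 // => *; exact: sqr_ge0.
  have := abs_le_sqr (q 0 (enum_rank ((e, i, j) : J))).
  have := abs_le_sqr (F j - colsq (toX q) j).
  have := ler_norm (colsq (toX q) j - F j); rewrite distrC.
  have := ler_norm (F j).
  rewrite /c; lra.
have S0 : S 0.
  rewrite /S /= (_ : toX 0 = 0) ?mul0mx //.
  by apply/matrixP => i j; rewrite !mxE.
have [q0 Sq0 q0min] := exists_min fC Scl S0 bound.
exists (toX q0) => // X XK.
pose q : 'rV[R]_#|J| := \row_k
  let: (e, i, j) := enum_val k in
  if e then complex.Im (X i j) else complex.Re (X i j).
have toXq : toX q = X.
  by apply/matrixP => i j; rewrite !mxE !enum_rankK; case: (X i j).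
by have := q0min q; rewrite /f /S /= toXq; apply.
Qed.

End LeastSquares.

Section Duality.
Local Open Scope sesquilinear_scope.
Variable R : realType.
Implicit Types z : R[i].

Lemma sqmodE z : (sqmod z)%:C%C = z * z^*.
Proof.
case: z => a b; rewrite /sqmod; apply/eqP; rewrite eq_complex /=.
by apply/andP; split; apply/eqP; ring.
Qed.

Lemma sqmod_ge0 z : 0 <= sqmod z.
Proof. by rewrite addr_ge0 ?sqr_ge0. Qed.

Lemma sqmodM (x y : R[i]) : sqmod (x * y) = sqmod x * sqmod y.
Proof. by case: x y => a b [c d]; rewrite /sqmod /=; ring. Qed.

Lemma sqmod_real (r : R) : sqmod r%:C%C = r ^+ 2.
Proof. by rewrite /sqmod /=; ring. Qed.

Lemma sqmodD (x y : R[i]) : sqmod (x + y) = sqmod x + sqmod y + 2 * complex.Re (x * y^*).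
Proof. by case: x y => a b [c d]; rewrite /sqmod /=; ring. Qed.

Lemma sqmod_eq0 z : (sqmod z == 0) = (z == 0).
Proof.
case: z => a b; rewrite /sqmod /= paddr_eq0 ?sqr_ge0 // !sqrf_eq0.
by rewrite eq_complex.
Qed.

(** First-order optimality: take d = a / (a + b). *)
Lemma le0_of_quadratic (a b : R) : 0 <= b ->
  (forall d, 0 <= d <= 1 -> d * a *+ 2 <= d ^+ 2 * b) -> a <= 0.
Proof.
move=> b0 ab; rewrite leNgt; apply/negP => a0.
have ab0 : 0 < a + b by rewrite ltr_pwDl.
pose e := a / (a + b).
have eE : e * (a + b) = a by rewrite divfK ?gt_eqF.
have e0 : 0 < e by rewrite divr_gt0.
have e1 : e <= 1 by rewrite -(ler_pM2r ab0) eE mul1r lerDl.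
have /ab : 0 <= e <= 1 by rewrite ltW.
have eb : e * b = a - e * a by move: eE; rewrite mulrDr; lra.
rewrite expr2 -mulrA eb mulrBr.
have := mulr_gt0 e0 (mulr_gt0 e0 a0); have := mulr_gt0 e0 a0.
lra.
Qed.

(** A matrix with one more row than columns has linearly dependent rows.  This
    spare direction is what lets [sos_duality_fin] add a new square to a sum of
    squares without changing the number of its terms. *)
Lemma unit_left_kernel n (X : 'M[R[i]]_(n.+1, n)) :
  exists2 r : 'rV[R[i]]_n.+1, r *m X = 0 & \sum_i sqmod (r 0 i) = 1.
Proof.
have : kermx X != 0.
  rewrite kermx_eq0 /row_free neq_ltn; apply/orP; left.
  by rewrite ltnS rank_leq_col.
case/rowV0Pn => v /sub_kermxP vX v0.
set s := \sum_i sqmod (v 0 i).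
have s0 : 0 < s.
  rewrite lt_neqAle sumr_ge0 ?andbT => [|i _]; last exact: sqmod_ge0.
  rewrite eq_sym psumr_neq0 => [|i _]; last exact: sqmod_ge0.
  case/rV0Pn: v0 => j vj; apply/hasP; exists j; first exact: mem_index_enum.
  by rewrite lt_neqAle sqmod_ge0 eq_sym sqmod_eq0 vj.
exists ((Num.sqrt s)^-1%:C%C *: v); first by rewrite -scalemxAl vX scaler0.
under eq_bigr do rewrite mxE sqmodM sqmod_real.
by rewrite -mulr_sumr -/s exprVn sqr_sqrtr ?mulVf // ?gt_eqF // ltW.
Qed.

(** Let X0 be a least squares solution with m + 1 rows in the row space of B and
    let d be its residual.  Two perturbations of X0 stay in the feasible set and move
    the column sums along a line: shrinking X0 by a scalar, and adding
    sqrt(e) r^* u, where u is in the row space of B and r is a unit vector of the left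
    kernel of X0, so that the cross terms vanish.  Optimality then gives
    d.G >= 0, where G is the vector of column sums of X0, and d.|u|^2 <= 0 for all u.
    Hence -d is an admissible L, so d.F <= 0, and d.d = d.F - d.G forces d = 0. *)
Lemma sos_duality_fin n m (B : 'M[R[i]]_(n, m)) (F : 'I_m -> R) :
  (forall L : 'I_m -> R,
     (forall c : 'rV_n, 0 <= \sum_j L j * sqmod ((c *m B) 0 j)) ->
     0 <= \sum_j L j * F j) ->
  exists V : 'M[R[i]]_(m.+1, n), forall j, F j = colsq (V *m B) j.
Proof.
move=> LF.
have [X0 X0B X0min] := least_squares m.+1 (cokermx B) F.
pose d j := F j - colsq X0 j.
have descent (H : 'I_m -> R) :
    (forall e, 0 <= e <= 1 -> exists2 X : 'M_(m.+1, m), X *m cokermx B = 0 &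
       forall j, colsq X j = colsq X0 j + e * H j) ->
    \sum_j d j * H j <= 0.
  move=> XH; apply: (@le0_of_quadratic _ (\sum_j H j ^+ 2)).
    by apply: sumr_ge0 => j _; exact: sqr_ge0.
  move=> e /XH[X /X0min + XE].
  have -> : \sum_j (F j - colsq X j) ^+ 2 = \sum_j d j ^+ 2
      - e * (\sum_j d j * H j) *+ 2 + e ^+ 2 * \sum_j H j ^+ 2.
    rewrite !mulr_sumr -sumrMnl -sumrB -big_split /=; apply: eq_bigr => j _.
    by rewrite XE /d; ring.
  rewrite -/d; lra.
have dX0 : 0 <= \sum_j d j * colsq X0 j.
  have : \sum_j d j * - colsq X0 j <= 0.
    apply: descent => e /andP[e0 e1].
    have e1' : 0 <= 1 - e by rewrite subr_ge0.
    exists ((Num.sqrt (1 - e))%:C%C *: X0); first by rewrite -scalemxAl X0B scaler0.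
    move=> j; rewrite /colsq; under eq_bigr do rewrite mxE sqmodM sqmod_real.
    by rewrite -mulr_sumr sqr_sqrtr // mulrN mulrBl mul1r.
  by under eq_bigr do rewrite mulrN; rewrite sumrN oppr_le0.
have dU (c : 'rV_n) : \sum_j d j * sqmod ((c *m B) 0 j) <= 0.
  have [r rX0 r1] := unit_left_kernel X0.
  apply: descent => e /andP[e0 e1].
  exists (X0 + (Num.sqrt e)%:C%C *: (r^t* *m (c *m B))).
    by rewrite mulmxDl X0B add0r -scalemxAl -!mulmxA mulmx_coker !mulmx0 scaler0.
  move=> j; rewrite /colsq.
  transitivity (\sum_i (sqmod (X0 i j) + (e * sqmod ((c *m B) 0 j)) * sqmod (r 0 i)
     + 2 * complex.Re (((Num.sqrt e)%:C%C * ((c *m B) 0 j)^*) * (r 0 i * X0 i j)))).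
    apply: eq_bigr => i _; rewrite !mxE big_ord1 !mxE sqmodD !sqmodM sqmod_real.
    rewrite sqr_sqrtr //; congr (_ + _ + 2 * complex.Re _).
      by rewrite /sqmod; case: (r 0 i) => ? ? /=; ring.
    rewrite !rmorphM /= conjCK.
    have -> : ((Num.sqrt e)%:C%C)^* = (Num.sqrt e)%:C%C :> R[i].
      by apply/CrealP; apply/complex_realP; exists (Num.sqrt e).
    ring.
  rewrite !big_split /= -!mulr_sumr r1 mulr1 -raddf_sum -mulr_sumr.
  have -> : \sum_i r 0 i * X0 i j = 0.
    by have /matrixP/(_ 0 j) := rX0; rewrite !mxE.
  by rewrite mulr0 mulr0 addr0.
have dF : \sum_j d j * F j <= 0.
  have := LF (fun j => - d j); under eq_bigr do rewrite mulNr.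
  rewrite sumrN oppr_ge0; apply=> c.
  by under eq_bigr do rewrite mulNr; rewrite sumrN oppr_ge0.
have d0 j : d j = 0.
  have : \sum_j d j ^+ 2 <= 0.
    have -> : \sum_j d j ^+ 2 = \sum_j d j * F j - \sum_j d j * colsq X0 j.
      by rewrite -sumrB; apply: eq_bigr => k _; rewrite -mulrBr -expr2.
    lra.
  have sq0 k (_ : true) : 0 <= d k ^+ 2 by exact: sqr_ge0.
  rewrite le_eqVlt ltNge sumr_ge0 // orbF psumr_eq0 // => /allP/(_ j).
  by rewrite mem_index_enum sqrf_eq0 => /(_ isT)/eqP.
have /submxP[V X0E] : (X0 <= B)%MS by rewrite submxE X0B.
by exists V => j; rewrite -X0E; apply/eqP; rewrite -subr_eq0 -/(d j) d0.
Qed.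

(** Add points whose value is not yet in the span until the dimension of the
    ambient space is exhausted. *)
Lemma finite_span (K : fieldType) (X : Type) N (f : X -> 'rV[K]_N) :
  exists m (t : 'I_m -> X), forall x, exists a : 'I_m -> K,
    f x = \sum_j a j *: f (t j).
Proof.
have step r : (exists s : seq X, forall x, f x \in <<map f s>>%VS) \/
    exists s : seq X, (r <= \dim <<map f s>>)%N.
  elim: r => [|r [|[s rs]]]; [by right; exists [::]|by left|].
  case: (boolp.pselect (forall x, f x \in <<map f s>>%VS)) => [fs|/boolp.existsNP[x]].
    by left; exists s.
  move=> /negP fx; right; exists (x :: s).
  apply: leq_ltn_trans rs _; rewrite /= span_cons.
  rewrite ltn_neqAle dimvS ?addvSr // andbT (dimv_leqif_eq (addvSr _ _)).
  apply: contra fx => /eqP E; rewrite E; apply/memv_addP.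
  by exists (f x); rewrite ?memv_line //; exists 0; rewrite ?mem0v ?addr0.
have [[s fs]|[s]] := step (\dim {: 'rV[K]_N}).+1; last first.
  by rewrite ltnNge dimvS // subvf.
exists (size s), (tnth (in_tuple s)) => x.
have /(@coord_span _ _ _ (map_tuple f (in_tuple s))) -> := fs x.
eexists; apply: eq_bigr => j _; rewrite -tnth_nth tnth_map.
reflexivity.
Qed.

(** Both F and all squared moduli |c b(x)|^2 are linear in the vector made of
    F(x) and the entries of b(x) b(x)^*.  Hence an equality between F and a sum of
    squared moduli on finitely many points that span these vectors holds everywhere,
    and the finite case applies. *)
Lemma sos_duality (X : Type) n (b : X -> 'cV[R[i]]_n) (F : X -> R) :
  (forall m (t : 'I_m -> X) (L : 'I_m -> R),
     (forall c : 'rV_n, 0 <= \sum_j L j * sqmod ((c *m b (t j)) 0 0)) ->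
     0 <= \sum_j L j * F (t j)) ->
  exists m (c : 'I_m -> 'rV[R[i]]_n),
    forall x, F x = \sum_i sqmod ((c i *m b x) 0 0).
Proof.
move=> LF.
pose f x : 'rV[R[i]]_(n * n + 1) := row_mx (mxvec (b x *m (b x)^t*)) (F x)%:C%C%:M.
have [m [t ft]] := finite_span f.
pose B := \matrix_(i < n, j < m) b (t j) i 0.
have cB (c : 'rV_n) j : (c *m B) 0 j = (c *m b (t j)) 0 0.
  by rewrite !mxE; apply: eq_bigr => i _; rewrite !mxE.
have [|V FV] := sos_duality_fin (B := B) (F := F \o t).
  move=> L LB; apply: LF => c.
  by move: (LB c); under eq_bigr do rewrite cB.
(* The terms of the sum are the rows of V; the identity extends from the points t to x. *)
exists m.+1, (fun i => row i V) => x; apply: complexI.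
have sqE (c : 'rV_n) y : (sqmod ((c *m b y) 0 0))%:C%C =
    \sum_k \sum_l c 0 k * (c 0 l)^* * (b y *m (b y)^t*) k l.
  rewrite sqmodE mxE rmorph_sum mulr_suml; apply: eq_bigr => k _.
  rewrite mulr_sumr; apply: eq_bigr => l _.
  by rewrite !mxE big_ord1 !mxE rmorphM /=; ring.
have [a] := ft x.
rewrite /f; under eq_bigr do rewrite scale_row_mx.
have row_sum p q (P : 'I_m -> 'rV[R[i]]_p) (Q : 'I_m -> 'rV_q) :
    \sum_j row_mx (P j) (Q j) = row_mx (\sum_j P j) (\sum_j Q j).
  elim/big_rec3: _ => [|j p1 p2 p3 _ ->]; first by rewrite row_mx0.
  by rewrite add_row_mx.
rewrite row_sum => /eq_row_mx[].
under eq_bigr do rewrite -linearZ.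
rewrite -linear_sum => /(can_inj mxvecK) bE /matrixP/(_ 0 0) FE.
have -> : (F x)%:C%C = \sum_j a j * (F (t j))%:C%C.
  by move: FE; rewrite mxE eqxx mulr1n summxE => ->;
    apply: eq_bigr => j _; rewrite !mxE eqxx mulr1n.
rewrite raddf_sum /=; under [RHS]eq_bigr do rewrite sqE bE.
transitivity (\sum_j a j * \sum_i (sqmod ((row i V *m b (t j)) 0 0))%:C%C).
  apply: eq_bigr => j _; rewrite -raddf_sum /=; congr (_ * _%:C%C).
  have /= -> := FV j; rewrite /colsq; apply: eq_bigr => i _.
  by rewrite -cB -row_mul [in RHS]mxE.
under [LHS]eq_bigr do rewrite mulr_sumr.
rewrite exchange_big /=; apply: eq_bigr => i _.
under [LHS]eq_bigr do rewrite sqE mulr_sumr.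
rewrite exchange_big /=; apply: eq_bigr => k _.
under [LHS]eq_bigr do rewrite mulr_sumr.
rewrite exchange_big /=; apply: eq_bigr => l _.
by rewrite summxE mulr_sumr; apply: eq_bigr => j _; rewrite [X in _ = _ * X]mxE mulrCA.
Qed.

End Duality.

(** * Polynomials in z and its conjugate are determined by their values *)

Section Vanishing.
Variable C : numClosedFieldType.

(** Uniqueness of digits in base D. *)
Lemma base_inj N D (f g : 'I_N -> nat) :
  (forall i, f i < D)%N -> (forall i, g i < D)%N ->
  (\sum_i f i * D ^ i = \sum_i g i * D ^ i)%N -> f =1 g.
Proof.
elim: N f g => [f g _ _ _ []//|N IH f g fD gD].
have D0 : (0 < D)%N by apply: leq_ltn_trans (fD ord0).
have shiftE (h : 'I_N.+1 -> nat) : (\sum_i h i * D ^ i =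
    h ord0 + (\sum_i h (lift ord0 i) * D ^ i) * D)%N.
  rewrite big_ord_recl expn0 muln1 big_distrl; congr addn.
  by apply: eq_bigr => i _; rewrite lift0 expnSr mulnA.
rewrite !shiftE => E.
have E0 : f ord0 = g ord0.
  by move/(congr1 (modn^~ D)): (E); rewrite ![(_ + _ * D)%N]addnC !modnMDl !modn_small.
move: E; rewrite E0 => /addnI/eqP; rewrite eqn_pmul2r // => /eqP /IH E1 i.
case: (unliftP ord0 i) => [j ->|-> //]; apply: E1 => k; [exact: fD|exact: gD].
Qed.

Lemma poly_nat_roots (p : {poly C}) : (forall k : nat, p.[k%:R] = 0) -> p = 0.
Proof.
move=> p0; apply/eqP; apply: contraT => pn0.
have := @max_poly_roots _ p [seq k%:R | k <- iota 0 (size p)] pn0.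
rewrite size_map size_iota ltnn; apply.
  by apply/allP => _ /mapP[k _ ->]; rewrite rootE p0.
by rewrite map_inj_uniq ?iota_uniq //; apply: mulrIn; exact: oner_neq0.
Qed.

(** Kronecker substitution: for D larger than all exponents, putting t^(D^i) for
    the i-th variable sends distinct monomials of Q to distinct powers of t, and a
    polynomial in one variable with infinitely many zeros is zero. *)
Lemma mpoly_nat_zeros N (Q : {mpoly C[N]}) :
  (forall k : 'I_N -> nat, Q.@[fun i => (k i)%:R] = 0) -> Q = 0.
Proof.
move=> Q0; pose D := (msize Q).+1.
pose wt (m : 'X_{1..N}) := (\sum_i m i * D ^ i)%N.
pose p : {poly C} := \sum_(m <- msupp Q) Q@_m *: 'X^(wt m).
have p0 : p = 0.
  apply: poly_nat_roots => k; rewrite horner_sum -[RHS](Q0 (fun i => k ^ (D ^ i))%N).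
  rewrite mevalE; apply: eq_bigr => m _; rewrite hornerZ hornerXn; congr (_ * _).
  rewrite -prodrXr; apply: eq_bigr => i _; by rewrite natrX -exprM mulnC.
have small m i : m \in msupp Q -> (m i < D)%N.
  move=> mQ; rewrite ltnS; apply: leq_trans (ltnW (msize_mdeg_lt mQ)).
  by rewrite mdegE (bigD1 i) //= leq_addr.
apply/mpolyP => m; rewrite mcoeff0; case: (boolP (m \in msupp Q)) => [mQ|]; last first.
  by move/memN_msupp_eq0.
have : p`_(wt m) = 0 by rewrite p0 coef0.
rewrite coef_sum (bigD1_seq m) //= coefZ coefXn eqxx mulr1 big_seq_cond big1 ?addr0 //.
move=> m' /andP[m'Q m'm]; rewrite coefZ coefXn; case: eqP => [E|]; last by rewrite mulr0.
case/eqP: m'm; apply/mnmP => i; symmetry; apply: base_inj E _ => j; exact: small.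
Qed.

(** Write z = u + iv.  The polynomial obtained by substituting u + iv and u - iv
    for z and conj z vanishes for real u and v, hence identically; as the
    substitution is invertible over the complex numbers, P is zero. *)
Lemma heval0_eq0 n (P : {mpoly C[n + n]}) : (forall z, heval P z = 0) -> P = 0.
Proof.
move=> P0.
(* The left half of the variables stands for u, the right half for v. *)
pose u (t : 'I_(n + n)) : {mpoly C[n + n]} :=
  match split t with
  | inl i => 'X_(lshift n i) + 'i *: 'X_(rshift n i)
  | inr i => 'X_(lshift n i) - 'i *: 'X_(rshift n i)
  end.
pose Q := P \mPo [tuple u t | t < n + n].
have Q0 : Q = 0.
  apply: mpoly_nat_zeros => k; rewrite comp_mpoly_meval.
  rewrite -[RHS](P0 (\col_i ((k (lshift n i))%:R + 'i * (k (rshift n i))%:R))).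
  apply: meval_eq => t; rewrite tnth_mktuple /u -[t in RHS]splitK /unsplit.
  case: (split t) => i; rewrite ?col_mxEu ?col_mxEd ?mxE ?mevalD ?mevalN ?mevalZ !mevalXU //.
  by rewrite rmorphD rmorphM /= conjCi !conjC_nat mulNr.
apply: mpoly_nat_zeros => k.
(* The complex point (u, v) with u + iv and u - iv prescribed. *)
pose w (t : 'I_(n + n)) : C :=
  match split t with
  | inl i => ((k (lshift n i))%:R + (k (rshift n i))%:R) / 2
  | inr i => ((k (lshift n i))%:R - (k (rshift n i))%:R) / (2 * 'i)
  end.
have : Q.@[w] = 0 by rewrite Q0 meval0.
rewrite comp_mpoly_meval => <-; apply: meval_eq => t.
rewrite tnth_mktuple /u -[t in LHS]splitK /unsplit.
have i0 : 'i != 0 :> C by exact: neq0Ci.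
case: (split t) => i; rewrite ?mevalD ?mevalN ?mevalZ !mevalXU /w
  !(unsplitK (inl _), unsplitK (inr _)).
  by field.
by field.
Qed.

Lemma heval_inj n (P Q : {mpoly C[n + n]}) :
  (forall z, heval P z = heval Q z) -> P = Q.
Proof.
move=> PQ; apply/eqP; rewrite -subr_eq0; apply/eqP/heval0_eq0 => z.
by rewrite /heval mevalB -!/(heval _ z) PQ subrr.
Qed.

Lemma heval_sum n (I : Type) (r : seq I) (F : I -> {mpoly C[n + n]}) z :
  heval (\sum_(i <- r) F i) z = \sum_(i <- r) heval (F i) z.
Proof. exact: raddf_sum. Qed.

End Vanishing.

(** * Conjugation of polynomials *)

Section Conjugation.
Variables (C : numClosedFieldType) (n : nat).
Implicit Types (P Q g : {mpoly C[n + n]}) (m : 'X_{1..n + n}) (z : 'cV[C]_n).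

Definition conj_var (v : 'I_(n + n)) : 'I_(n + n) :=
  match split v with inl i => rshift n i | inr i => lshift n i end.

Lemma conj_varl i : conj_var (lshift n i) = rshift n i.
Proof. by rewrite /conj_var (unsplitK (inl _)). Qed.

Lemma conj_varr i : conj_var (rshift n i) = lshift n i.
Proof. by rewrite /conj_var (unsplitK (inr _)). Qed.

Lemma conj_varK : involutive conj_var.
Proof.
by move=> v; rewrite -[v]splitK; case: (split v) => i; rewrite /= ?(conj_varl, conj_varr).
Qed.

Definition conj_mnm m := [multinom m (conj_var v) | v < n + n].

Lemma conj_mnmK : involutive conj_mnm.
Proof. by move=> m; apply/mnmP => v; rewrite !mnmE conj_varK. Qed.

Lemma conj_mnmD m1 m2 : conj_mnm (m1 + m2) = (conj_mnm m1 + conj_mnm m2)%MM.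
Proof. by apply/mnmP => v; rewrite !mnmE. Qed.

Lemma conj_mnm0 : conj_mnm 0 = 0%MM.
Proof. by apply/mnmP => v; rewrite !mnmE. Qed.

Lemma conj_mnmU v : conj_mnm U_(v)%MM = U_(conj_var v)%MM.
Proof. by apply/mnmP => w; rewrite !mnmE (inv_eq conj_varK). Qed.

Lemma conj_mnm_sum (I : Type) (r : seq I) (f : I -> 'X_{1..n + n}) :
  conj_mnm (\sum_(i <- r) f i)%MM = (\sum_(i <- r) conj_mnm (f i))%MM.
Proof. exact: (big_morph _ conj_mnmD conj_mnm0). Qed.

Definition conj_mpoly P := \sum_(m <- msupp P) (P@_m)^* *: 'X_[conj_mnm m].

Lemma mcoeff_sumX P (f : 'X_{1..n + n} -> C) (A : pred 'X_{1..n + n}) m :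
  (forall m', m' \notin msupp P -> f m' = 0) ->
  (\sum_(m' <- msupp P | A m') f m' *: 'X_[m'])@_m = f m *+ A m.
Proof.
move=> f0; rewrite raddf_sum /=.
under eq_bigr do rewrite mcoeffZ mcoeffX.
case: (boolP (m \in msupp P)) => [mP|mP]; last first.
  rewrite f0 // mul0rn big_seq_cond big1 // => m' /andP[m'P _].
  by case: eqP m'P mP => [->->//|]; rewrite mulr0.
rewrite big_mkcond (bigD1_seq m) //= eqxx mulr1 big1 ?addr0; last first.
  by move=> m' /negPf ->; rewrite mulr0 if_same.
by case: (A m).
Qed.

Lemma mcoeff_conj P m : (conj_mpoly P)@_m = (P@_(conj_mnm m))^*.
Proof.
transitivity ((\sum_(m' <- msupp P) (P@_m')^* *: 'X_[m'])@_(conj_mnm m)); last first.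
  rewrite (mcoeff_sumX (f := fun m => (P@_m)^*) xpredT) // => m' /memN_msupp_eq0->.
  exact: conjC0.
rewrite !raddf_sum; apply: eq_bigr => m' _ /=.
by rewrite !mcoeffZ !mcoeffX (inv_eq conj_mnmK).
Qed.

Lemma heval_conj P z : heval (conj_mpoly P) z = (heval P z)^*.
Proof.
rewrite /heval [in RHS]mevalE rmorph_sum /conj_mpoly raddf_sum /=.
apply: eq_bigr => m _; rewrite mevalZ mevalX rmorphM /= rmorph_prod; congr (_ * _).
rewrite (reindex_inj (inv_inj conj_varK)) /=; apply: eq_bigr => v _.
rewrite mnmE conj_varK rmorphXn /=; congr (_ ^+ _).
rewrite -[v]splitK; case: (split v) => i;
  rewrite /= ?(conj_varl, conj_varr) ?col_mxEu ?col_mxEd !mxE //.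
by rewrite conjCK.
Qed.

Lemma hermitianP P : hermitian_poly P <-> conj_mpoly P = P.
Proof.
split=> [PR|PE z]; last by apply/CrealP; rewrite -heval_conj PE.
apply: heval_inj => z; rewrite heval_conj; exact/CrealP/PR.
Qed.

Lemma conj_sqr P z : heval (P * conj_mpoly P) z = `|heval P z| ^+ 2.
Proof. by rewrite normCK -heval_conj /heval mevalM. Qed.

Lemma conj_mpolyD P Q : conj_mpoly (P + Q) = conj_mpoly P + conj_mpoly Q.
Proof. by apply/mpolyP => m; rewrite mcoeffD !mcoeff_conj mcoeffD rmorphD. Qed.

Lemma conj_mpolyZ a P : conj_mpoly (a *: P) = a^* *: conj_mpoly P.
Proof. by apply/mpolyP => m; rewrite mcoeffZ !mcoeff_conj mcoeffZ rmorphM. Qed.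

Lemma conj_mpolyX (m : 'X_{1..n + n}) : conj_mpoly 'X_[C, m] = 'X_[conj_mnm m].
Proof.
by apply/mpolyP => m'; rewrite mcoeff_conj !mcoeffX conjC_nat (inv_eq conj_mnmK).
Qed.

Lemma conj_mpoly0 : conj_mpoly 0 = 0 :> {mpoly C[n + n]}.
Proof. by apply/mpolyP => m; rewrite mcoeff_conj !mcoeff0 conjC0. Qed.

Lemma conj_mpoly_sum (I : Type) (r : seq I) (p : pred I) (F : I -> {mpoly C[n + n]}) :
  conj_mpoly (\sum_(i <- r | p i) F i) = \sum_(i <- r | p i) conj_mpoly (F i).
Proof. exact: (big_morph _ conj_mpolyD conj_mpoly0). Qed.

End Conjugation.

(** * Homogeneous parts of sums of squares *)

Section Homogenisation.
Variables (C : numClosedFieldType) (n : nat) (wt : 'X_{1..n + n} -> nat).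
Hypothesis wtD : forall m1 m2, wt (m1 + m2)%MM = (wt m1 + wt m2)%N.
Hypothesis wt_conj : forall m, wt (conj_mnm m) = wt m.
Implicit Types (P g : {mpoly C[n + n]}) (m : 'X_{1..n + n}).

Definition homog_part k P := \sum_(m <- msupp P | wt m == k) P@_m *: 'X_[m].

Lemma mcoeff_homog_part k P m : (homog_part k P)@_m = P@_m *+ (wt m == k).
Proof.
by apply: (mcoeff_sumX (fun m => wt m == k)) => m' /memN_msupp_eq0.
Qed.

Lemma hermitian_homog_part k P : hermitian_poly P -> hermitian_poly (homog_part k P).
Proof.
move=> /hermitianP PE; apply/hermitianP/mpolyP => m.
rewrite mcoeff_conj !mcoeff_homog_part rmorphMn wt_conj /=.
by rewrite -[in RHS]PE mcoeff_conj.
Qed.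

(** If the parts of g of weight below k vanish, only the part of weight k can
    contribute to the coefficients of g^2 of weight 2k. *)
Lemma homog_part_sqr k g m :
  (forall a, (a < k)%N -> homog_part a g = 0) ->
  ((homog_part k g) ^+ 2)@_m = (g ^+ 2)@_m *+ (wt m == k.*2).
Proof.
move=> g0.
have low m' : (wt m' < k)%N -> g@_m' = 0.
  by move=> /g0/mpolyP/(_ m'); rewrite mcoeff_homog_part mcoeff0 eqxx.
rewrite !expr2 !mcoeffM -sumrMnl; apply: eq_bigr => -[m1 m2] /= /eqP mE.
have {mE} -> : wt m = (wt m1 + wt m2)%N by rewrite -wtD -mE.
rewrite !mcoeff_homog_part.
case: (ltnP (wt m1) k) => [/low ->|k1]; first by rewrite !mul0rn !mul0r mul0rn.
case: (ltnP (wt m2) k) => [/low ->|k2]; first by rewrite !mul0rn !mulr0 mul0rn.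
have -> : (wt m1 + wt m2 == k.*2)%N = (wt m1 == k) && (wt m2 == k) by lia.
by case: eqP => _; case: eqP => _; rewrite /= ?mulr0n ?mulr1n ?mul0r ?mulr0.
Qed.

(** By induction on a < k, the parts of weight a vanish: the squares of these parts
    sum to the part of P of weight 2a, which is zero, and their values are real. *)
Lemma homog_sos k P (gs : seq {mpoly C[n + n]}) :
  (forall g, g \in gs -> hermitian_poly g) ->
  (forall m, P@_m != 0 -> wt m = k.*2) ->
  P = \sum_(g <- gs) g ^+ 2 ->
  P = \sum_(g <- gs) (homog_part k g) ^+ 2.
Proof.
move=> gsR Pk PE.
have sqE a : (forall g, g \in gs -> forall a', (a' < a)%N -> homog_part a' g = 0) ->
    forall m, (\sum_(g <- gs) (homog_part a g) ^+ 2)@_m = P@_m *+ (wt m == a.*2).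
  move=> low m; rewrite PE !raddf_sum -sumrMnl /= big_seq [RHS]big_seq.
  by apply: eq_bigr => g /low ?; rewrite homog_part_sqr.
have low a : (a < k)%N -> forall g, g \in gs -> homog_part a g = 0.
  elim/ltn_ind: a => a IH ak.
  have /sqE sqaE : forall g, g \in gs -> forall a', (a' < a)%N -> homog_part a' g = 0.
    by move=> g gg a' a'a; apply: IH => //; exact: ltn_trans ak.
  have sq0 : \sum_(g <- gs) (homog_part a g) ^+ 2 = 0.
    apply/mpolyP => m; rewrite sqaE mcoeff0.
    case: (eqVneq (P@_m) 0) => [->|/Pk ->]; first by rewrite mul0rn.
    by case: eqP => // /double_inj E; rewrite E ltnn in ak.
  move=> g gg; apply: heval0_eq0 => z; apply/eqP; rewrite -sqrf_eq0; apply/eqP.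
  have /eqP := congr1 (fun P => heval P z) sq0.
  rewrite /heval meval0 raddf_sum /= big_seq psumr_eq0 => [/allP/(_ g gg)|g' g'g].
    by rewrite gg /= rmorphXn => /eqP.
  by rewrite rmorphXn /= real_exprn_even_ge0 //; apply: hermitian_homog_part; exact: gsR.
apply/mpolyP => m; rewrite sqE => [|g gg a /low/(_ g gg)//].
by case: (eqVneq (P@_m) 0) => [->|/Pk ->]; rewrite ?mul0rn // eqxx.
Qed.

End Homogenisation.

(** * Monomials indexed by words *)

Section WordMonomials.
Variables dA dB l : nat.
Let n := (dA + dB)%N.
Implicit Types (i k : 'I_dA) (j : 'I_dB) (b c : word l dB) (m : 'X_{1..n + n}).

Definition vx i : 'I_(n + n) := lshift n (lshift dB i).
Definition vy j : 'I_(n + n) := lshift n (rshift dA j).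
Definition vxbar i : 'I_(n + n) := rshift n (lshift dB i).
Definition vybar j : 'I_(n + n) := rshift n (rshift dA j).

Lemma eq_vars :
  (forall i i', (vx i == vx i') = (i == i')) *
  (forall i i', (vxbar i == vxbar i') = (i == i')) *
  (forall j j', (vy j == vy j') = (j == j')) *
  (forall j j', (vybar j == vybar j') = (j == j')) *
  (forall i i', (vx i == vxbar i') = false) * (forall i i', (vxbar i == vx i') = false) *
  (forall i j, (vx i == vy j) = false) * (forall i j, (vy j == vx i) = false) *
  (forall i j, (vx i == vybar j) = false) * (forall i j, (vybar j == vx i) = false) *
  (forall i j, (vxbar i == vy j) = false) * (forall i j, (vy j == vxbar i) = false) *
  (forall i j, (vxbar i == vybar j) = false) * (forall i j, (vybar j == vxbar i) = false) *
  (forall j j', (vy j == vybar j') = false) * (forall j j', (vybar j == vy j') = false).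
Proof.
by repeat split; move=> p q; rewrite /vx /vy /vxbar /vybar ?(inj_eq (@lshift_inj _ _))
  ?(inj_eq (@rshift_inj _ _)) ?eq_lrshift ?eq_rlshift ?eq_lshift ?eq_rshift.
Qed.

Lemma conj_vars :
  (forall i, conj_var (vx i) = vxbar i) * (forall j, conj_var (vy j) = vybar j) *
  (forall i, conj_var (vxbar i) = vx i) * (forall j, conj_var (vybar j) = vy j).
Proof. by repeat split=> *; rewrite ?conj_varl ?conj_varr. Qed.

Lemma varP (v : 'I_(n + n)) :
  [\/ exists i, v = vx i, exists j, v = vy j, exists i, v = vxbar i | exists j, v = vybar j].
Proof.
rewrite -[v]splitK; case: (split v) => w; rewrite -[w]splitK; case: (split w) => u;
  by [constructor 1; exists u|constructor 2; exists u
     |constructor 3; exists u|constructor 4; exists u].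
Qed.

(** The monomial x_i conj(y_(b_1) ... y_(b_s)) y_(b_(s+1)) ... y_(b_l): half of the
    degree of the monomials that pair with an operator on A B_1 ... B_l. *)
Definition half_mnm (s : nat) i b : 'X_{1..n + n} :=
  (U_(vx i) + \sum_(p < l) U_(if (p < s)%N then vybar (b p) else vy (b p)))%MM.

(** The monomial x_i y^b conj(x_k y^c). *)
Definition full_mnm i b k c : 'X_{1..n + n} :=
  (half_mnm 0 i b + conj_mnm (half_mnm 0 k c))%MM.

Lemma conj_half_mnm s i b : conj_mnm (half_mnm s i b) =
  (U_(vxbar i) + \sum_(p < l) U_(if (p < s)%N then vy (b p) else vybar (b p)))%MM.
Proof.
rewrite conj_mnmD conj_mnm_sum conj_mnmU conj_vars; congr (_ + _)%MM.
by apply: eq_bigr => p _; rewrite conj_mnmU; case: ifP; rewrite conj_vars.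
Qed.

(** This is where the partial transpose enters: conjugating the first s letters
    of each half exchanges these letters between b and c in the product. *)
Lemma half_mnmM s i b k c : (half_mnm s i b + conj_mnm (half_mnm s k c))%MM =
  full_mnm i (first_from s c b) k (first_from s b c).
Proof.
rewrite /full_mnm !conj_half_mnm /half_mnm.
apply/mnmP => v; rewrite !mnmDE !mnm_sumE.
rewrite addnACA [in RHS]addnACA; congr addn.
rewrite -!big_split; apply: eq_bigr => p _ /=; rewrite /first_from !ffunE.
by case: ifP => //; rewrite addnC.
Qed.

Definition deg_in (T : finType) (f : T -> 'I_(n + n)) m := (\sum_t m (f t))%N.

Lemma deg_inD (T : finType) (f : T -> 'I_(n + n)) m1 m2 :
  deg_in f (m1 + m2)%MM = (deg_in f m1 + deg_in f m2)%N.
Proof. by rewrite -big_split; apply: eq_bigr => t _; rewrite mnmDE. Qed.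

Lemma deg_in_sum (T I : finType) (f : T -> 'I_(n + n)) (F : I -> 'X_{1..n + n}) :
  deg_in f (\sum_i F i)%MM = (\sum_i deg_in f (F i))%N.
Proof.
by rewrite exchange_big; apply: eq_bigr => t _; rewrite mnm_sumE.
Qed.

Lemma deg_inU (T : finType) (f : T -> 'I_(n + n)) v :
  deg_in f U_(v)%MM = (\sum_t (v == f t))%N.
Proof. by apply: eq_bigr => t _; rewrite mnm1E. Qed.

Lemma deg_conj (T : finType) (f : T -> 'I_(n + n)) m :
  deg_in f (conj_mnm m) = deg_in (fun t => conj_var (f t)) m.
Proof. by apply: eq_bigr => t _; rewrite mnmE. Qed.

Lemma conj_mnm_deg m :
  [/\ deg_in vx (conj_mnm m) = deg_in vxbar m,
      deg_in vxbar (conj_mnm m) = deg_in vx m,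
      deg_in vy (conj_mnm m) = deg_in vybar m &
      deg_in vybar (conj_mnm m) = deg_in vy m].
Proof. by split; rewrite deg_conj; apply: eq_bigr => t _; rewrite conj_vars. Qed.

Lemma sum_eq1 (T : finType) (t : T) : (\sum_t' (t == t'))%N = 1%N.
Proof. by rewrite (bigD1 t) //= eqxx big1 // => t'; rewrite eq_sym => /negPf->. Qed.

Lemma deg_half s i b : (s <= l)%N ->
  [/\ deg_in vx (half_mnm s i b) = 1%N, deg_in vxbar (half_mnm s i b) = 0%N,
      deg_in vy (half_mnm s i b) = (l - s)%N & deg_in vybar (half_mnm s i b) = s].
Proof.
move=> sl; rewrite /half_mnm; split; rewrite deg_inD deg_in_sum deg_inU.
- under eq_bigr do rewrite eq_vars; rewrite sum_eq1 big1 // => p _.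
  by rewrite deg_inU big1 // => t _; case: ifP; rewrite eq_vars.
- rewrite big1 => [|t _]; last by rewrite eq_vars.
  by rewrite big1 // => p _; rewrite deg_inU big1 // => t _; case: ifP; rewrite eq_vars.
- rewrite big1 => [|t _]; last by rewrite eq_vars.
  transitivity (\sum_(p < l) ~~ (p < s))%N.
    apply: eq_bigr => p _; rewrite deg_inU; case: ifP => _.
      by rewrite big1 // => t _; rewrite eq_vars.
    by under eq_bigr do rewrite eq_vars; rewrite sum_eq1.
  rewrite -(big_mkord xpredT (fun p => ~~ (p < s) : nat)%N) (@big_cat_nat _ _ _ s) //=.
  rewrite big_nat big1 => [|p /andP[_ ->]//].
  rewrite add0n big_nat (eq_bigr (fun=> 1%N)) => [|p /andP[sp _]]; last by rewrite ltnNge sp.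
  by rewrite -big_nat sum_nat_const_nat muln1.
- rewrite big1 => [|t _]; last by rewrite eq_vars.
  transitivity (\sum_(p < l) (p < s))%N.
    apply: eq_bigr => p _; rewrite deg_inU; case: ifP => _.
      by under eq_bigr do rewrite eq_vars; rewrite sum_eq1.
    by rewrite big1 // => t _; rewrite eq_vars.
  rewrite -(big_mkord xpredT (fun p => (p < s) : nat)%N) (@big_cat_nat _ _ _ s) //=.
  rewrite [X in (_ + X)%N]big_nat [X in (_ + X)%N]big1 => [|p /andP[sp _]];
    last by rewrite ltnNge sp.
  rewrite addn0 big_nat (eq_bigr (fun=> 1%N)) => [|p /andP[_ ->]//].
  by rewrite -big_nat sum_nat_const_nat muln1 subn0.
Qed.

Lemma seq_of_counts (T : finType) (f : T -> nat) N : (\sum_t f t)%N = N ->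
  exists t : seq T, size t = N /\ forall a, count_mem a t = f a.
Proof.
elim: N f => [|N IH] f fN; first move: fN => /eqP.
  by rewrite sum_nat_eq0 => /forallP f0; exists [::]; split=> // a; rewrite (eqP (f0 a)).
have [a fa] : exists a, (0 < f a)%N.
  apply/existsP; apply: contraT => /existsPn f0.
  by move: fN; rewrite big1 // => a _; apply/eqP; rewrite -leqn0 leqNgt f0.
have [|t [tN tf]] := IH (fun a' => f a' - (a == a'))%N.
  move: fN; rewrite (bigD1 a) //= [in X in _ -> X](bigD1 a) //= eqxx.
  have -> : (\sum_(a' | a' != a) (f a' - (a == a')) = \sum_(a' | a' != a) f a')%N.
    by apply: eq_bigr => a' a'a; rewrite eq_sym (negPf a'a) subn0.
  lia.
exists (a :: t); split=> [|a'] /=; first by rewrite tN.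
by rewrite tf; case: eqP => [<-|_]; lia.
Qed.

(** The word b lists first the indices of the conj(y) and then those of the y,
    each as often as its exponent. *)
Lemma half_mnm_exists (j0 : 'I_dB) s m : (s <= l)%N ->
  deg_in vx m = 1%N -> deg_in vxbar m = 0%N ->
  deg_in vy m = (l - s)%N -> deg_in vybar m = s ->
  exists i b, m = half_mnm s i b.
Proof.
move=> sl mx mxb my myb.
have [tx [tx1 txE]] := seq_of_counts mx.
case: tx tx1 txE => [//|i [|//]] _ txE.
have [ty [szy tyE]] := seq_of_counts my.
have [tyb [szyb tybE]] := seq_of_counts myb.
exists i, [ffun p : 'I_l => nth j0 (tyb ++ ty) p].
have count_nth (t : seq 'I_dB) j : (\sum_(0 <= p < size t) (nth j0 t p == j))%N = count_mem j t.
  by rewrite -sum1_count (big_nth j0) [RHS]big_mkcond; apply: eq_bigr => p _ /=; case: eqP.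
apply/mnmP => v; rewrite /half_mnm mnmDE mnm_sumE.
case: (varP v) => -[u ->]; rewrite mnm1E eq_vars.
- rewrite -txE /= addn0 big1 ?addn0 // => p _.
  by rewrite mnm1E; case: ifP; rewrite eq_vars.
- rewrite -tyE add0n.
  transitivity (\sum_(p < l) 
      (if p < s then 0 else nat_of_bool (nth j0 (tyb ++ ty) p == u)))%N; last first.
    by apply: eq_bigr => p _; rewrite mnm1E ffunE; case: ifP; rewrite eq_vars.
  rewrite -(big_mkord xpredT
    (fun p => if p < s then 0 else nat_of_bool (nth j0 (tyb ++ ty) p == u))%N).
  rewrite (@big_cat_nat _ _ _ s) //= big_nat big1 => [|p /andP[_ ->]//].
  rewrite add0n -{1}[s]add0n big_addn -count_nth szy big_nat [RHS]big_nat.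
  apply: eq_bigr => p _; rewrite ltnNge leq_addl /= nth_cat szyb.
  by rewrite ltnNge leq_addl /= addnK.
- rewrite add0n big1 => [|p _]; last by rewrite mnm1E; case: ifP; rewrite eq_vars.
  by move/eqP: mxb; rewrite sum_nat_eq0 => /forallP/(_ u)/eqP.
- rewrite -tybE add0n.
  transitivity (\sum_(p < l) 
      (if p < s then nat_of_bool (nth j0 (tyb ++ ty) p == u) else 0))%N; last first.
    by apply: eq_bigr => p _; rewrite mnm1E ffunE; case: ifP; rewrite eq_vars.
  rewrite -(big_mkord xpredT
    (fun p => if p < s then nat_of_bool (nth j0 (tyb ++ ty) p == u) else 0)%N).
  rewrite (@big_cat_nat _ _ _ s) //= [X in (_ + X)%N]big_nat.
  rewrite [X in (_ + X)%N]big1 => [|p /andP[sp _]]; last by rewrite ltnNge sp.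
  rewrite addn0 -count_nth szyb big_nat [RHS]big_nat.
  by apply: eq_bigr => p /andP[_ ps]; rewrite ps nth_cat szyb ps.
Qed.

Lemma word_perm b b' :
  (forall j, (\sum_p (b p == j))%N = (\sum_p (b' p == j))%N) ->
  exists s : 'S_l, b' = [ffun p => b (s p)].
Proof.
move=> bb'.
have cnt (a : word l dB) j : count_mem j [tuple a p | p < l] = (\sum_p (a p == j))%N.
  by rewrite count_map -sum1_count big_enum_cond big_mkcond; apply: eq_bigr => p _ /=; case: eqP.
have /tuple_permP[s E] : perm_eq [tuple b' p | p < l] [tuple b p | p < l].
  by apply/allP => j _ /=; rewrite !cnt bb'.
exists s; apply/ffunP => p; rewrite ffunE.
rewrite -[LHS](tnth_mktuple b') (val_inj E : [tuple b' p | p < l] = _).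
by rewrite !tnth_mktuple.
Qed.

Lemma full_mnmE i b k c :
  (forall i', full_mnm i b k c (vx i') = (i == i')) *
  (forall k', full_mnm i b k c (vxbar k') = (k == k')) *
  (forall j, full_mnm i b k c (vy j) = \sum_p (b p == j))%N *
  (forall j, full_mnm i b k c (vybar j) = \sum_p (c p == j))%N.
Proof.
rewrite /full_mnm !conj_half_mnm /half_mnm.
have sum0 (a : word l dB) (f : 'I_dB -> 'I_(n + n)) v : (forall j, (f j == v) = false) ->
    (\sum_(p < l) (U_(f (a p))%MM v : nat))%N = 0%N.
  by move=> fv; rewrite big1 // => p _; rewrite mnm1E fv.
do 3?split; move=> u; rewrite !mnmDE !mnm_sumE !mnm1E !eq_vars.
- by rewrite !sum0 ?addn0 // => j; rewrite eq_vars.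
- by rewrite !sum0 ?addn0 // => j; rewrite eq_vars.
- rewrite (sum0 c) ?addn0 => [|j]; last by rewrite eq_vars.
  by apply: eq_bigr => p _; rewrite mnm1E eq_vars.
- rewrite (sum0 b) ?add0n => [|j]; last by rewrite eq_vars.
  by apply: eq_bigr => p _; rewrite mnm1E eq_vars.
Qed.

(** A monomial determines its words up to a permutation of the letters, so that a
    symmetric sigma takes one value on all index pairs of a given monomial. *)
Lemma full_mnm_inj i b k c i' b' k' c' :
  full_mnm i b k c = full_mnm i' b' k' c' ->
  [/\ i = i', k = k', exists s : 'S_l, b' = [ffun p => b (s p)] &
      exists s : 'S_l, c' = [ffun p => c (s p)]].
Proof.
move=> E; split.
- by have /mnmP/(_ (vx i)) := E; rewrite !full_mnmE eqxx; case: eqP.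
- by have /mnmP/(_ (vxbar k)) := E; rewrite !full_mnmE eqxx; case: eqP.
- by apply: word_perm => j; have /mnmP/(_ (vy j)) := E; rewrite !full_mnmE.
- by apply: word_perm => j; have /mnmP/(_ (vybar j)) := E; rewrite !full_mnmE.
Qed.

Lemma deg_full i b k c :
  [/\ deg_in vx (full_mnm i b k c) = 1%N, deg_in vxbar (full_mnm i b k c) = 1%N,
      deg_in vy (full_mnm i b k c) = l & deg_in vybar (full_mnm i b k c) = l].
Proof.
have [bx bxb by_ byb] := deg_half i b (leq0n l).
have [cx cxb cy cyb] := deg_half k c (leq0n l).
have [ex exb ey eyb] := conj_mnm_deg (half_mnm 0 k c).
have sumE (T : finType) (f : T -> 'I_(n + n)) :=
  deg_inD f (half_mnm 0 i b) (conj_mnm (half_mnm 0 k c)).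
rewrite /full_mnm !sumE bx bxb by_ byb ex exb ey eyb cx cxb cy cyb.
by rewrite subn0 !addn0.
Qed.

End WordMonomials.

(** * Moment matrices *)

Section Moments.
Local Open Scope sesquilinear_scope.
Variables (C : numClosedFieldType) (dA dB l : nat).
Let n := (dA + dB)%N.
Let W : finType := word l dB.
Let E := (dA * #|{: W}|)%N.
Implicit Types (i k : 'I_dA) (b c : W) (u w : 'I_E) (sigma : 'M[C]_E).

Definition ext_unindex u : 'I_dA * W :=
  let (i, e) := mxtens_unindex u in (i, enum_val e).

Lemma ext_indexK i b : ext_unindex (ext_index i b) = (i, b).
Proof. by rewrite /ext_unindex /ext_index mxtens_indexK enum_rankK. Qed.

Lemma ext_unindexK u : ext_index (ext_unindex u).1 (ext_unindex u).2 = u.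
Proof.
rewrite /ext_unindex /ext_index -[u in RHS]mxtens_unindexK.
by case: (mxtens_unindex u) => i e; rewrite /= enum_valK.
Qed.

Definition half_mnm_at (s : nat) u := half_mnm s (ext_unindex u).1 (ext_unindex u).2.
Definition full_mnm_at u w :=
  full_mnm (ext_unindex u).1 (ext_unindex u).2 (ext_unindex w).1 (ext_unindex w).2.

Lemma half_mnm_at_deg s u : (s <= l)%N ->
  [/\ deg_in (@vx dA dB) (half_mnm_at s u) = 1%N,
      deg_in (@vxbar dA dB) (half_mnm_at s u) = 0%N,
      deg_in (@vy dA dB) (half_mnm_at s u) = (l - s)%N &
      deg_in (@vybar dA dB) (half_mnm_at s u) = s].
Proof. exact: deg_half. Qed.

Lemma deg_full_at u w :
  [/\ deg_in (@vx dA dB) (full_mnm_at u w) = 1%N, deg_in (@vxbar dA dB) (full_mnm_at u w) = 1%N,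
      deg_in (@vy dA dB) (full_mnm_at u w) = l & deg_in (@vybar dA dB) (full_mnm_at u w) = l].
Proof. exact: deg_full. Qed.

Definition word_poly (s : nat) (v : 'cV[C]_E) : {mpoly C[n + n]} :=
  \sum_u v u 0 *: 'X_[half_mnm_at s u].

(** Row and column are exchanged so that the trace of M times a partial trace of
    sigma, and not of its transpose, is a value of Phi. *)
Definition has_moments (Phi : {scalar {mpoly C[n + n]}}) sigma :=
  forall u w, Phi 'X_[full_mnm_at u w] = sigma w u.

Lemma ptransposeE s sigma u w : ptranspose s sigma u w =
  sigma (ext_index (ext_unindex u).1 (first_from s (ext_unindex w).2 (ext_unindex u).2))
        (ext_index (ext_unindex w).1 (first_from s (ext_unindex u).2 (ext_unindex w).2)).
Proof.
rewrite mxE /ext_unindex; case: (mxtens_unindex u) => i e.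
by case: (mxtens_unindex w) => k f.
Qed.

Lemma ptranspose0 sigma : ptranspose 0 sigma = sigma.
Proof.
apply/matrixP => u w; rewrite ptransposeE.
have first0 b c : first_from 0 b c = c by apply/ffunP => p; rewrite ffunE.
by rewrite !first0 !ext_unindexK.
Qed.

Lemma moment_monomial Phi sigma s u w : has_moments Phi sigma ->
  Phi ('X_[half_mnm_at s u] * 'X_[conj_mnm (half_mnm_at s w)]) = ptranspose s sigma w u.
Proof.
move=> PhiE; rewrite -mpolyXD /half_mnm_at half_mnmM ptransposeE -PhiE /full_mnm_at !ext_indexK.
by [].
Qed.

(** Expand both factors: by [half_mnmM] each product of two monomials is a moment,
    found in sigma at an entry of its partial transpose. *)
Lemma moment_word_poly Phi sigma s v v' : has_moments Phi sigma ->
  Phi (word_poly s v * conj_mpoly (word_poly s v')) =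
  (v'^t* *m ptranspose s sigma *m v) 0 0.
Proof.
move=> PhiE; rewrite /word_poly conj_mpoly_sum mulr_suml linear_sum mxE /=.
apply: eq_bigr => u _; rewrite mulr_sumr linear_sum mxE mulr_suml /=.
apply: eq_bigr => w _; rewrite conj_mpolyZ conj_mpolyX -scalerAl -scalerAr.
rewrite !linearZ /= (moment_monomial _ _ _ PhiE) !mxE; ring.
Qed.

Definition row_symmetric sigma := forall (s : 'S_l) i b u,
  sigma (ext_index i [ffun p => b (s p)]) u = sigma (ext_index i b) u.

Lemma sum_ext_index (F : 'I_E -> C) : \sum_u F u = \sum_i \sum_b F (ext_index i b).
Proof.
rewrite pair_bigA /= (reindex (fun p : 'I_dA * W => ext_index p.1 p.2)) //.
exists ext_unindex => [[i b] _|u _]; [exact: ext_indexK|exact: ext_unindexK].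
Qed.

(** Each column of sigma, restricted to a basis vector of A, is a vector of the
    tensor power of B, to which [sym_projP] applies. *)
Lemma tens_sym_projP sigma :
  (1%:M *t sym_proj C dB l) *m sigma = sigma <-> row_symmetric sigma.
Proof.
have [_ _ fixP] := sym_projP C dB l.
pose v i u : 'cV[C]_#|{: W}| := \col_e sigma (mxtens_index (i, e)) u.
have prodE i e u : ((1%:M *t sym_proj C dB l) *m sigma) (mxtens_index (i, e)) u =
    (sym_proj C dB l *m v i u) e 0.
  rewrite mxE sum_ext_index (bigD1 i) //= [X in _ + X]big1 ?addr0 => [|k ki]; last first.
    by rewrite big1 // => b _; rewrite tensmxE mxE eq_sym (negPf ki) !mul0r.
  rewrite mxE (reindex (@enum_val W xpredT)) /=; last first.
    by exists enum_rank => x _; [exact: enum_valK|exact: enum_rankK].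
  apply: eq_bigr => f _; rewrite /ext_index enum_valK tensmxE !mxE eqxx mul1r.
  by [].
split=> [fix_sigma s i b u|sym].
  have /fixP/(_ s b) : sym_proj C dB l *m v i u = v i u.
    by apply/colP => e; rewrite -prodE fix_sigma mxE.
  by rewrite !mxE.
apply/matrixP => x u; rewrite -[x]mxtens_unindexK; case: (mxtens_unindex x) => i e.
rewrite prodE (_ : _ *m _ = v i u) ?mxE //.
by apply/fixP => s b; rewrite !mxE; exact: sym.
Qed.

Lemma hermsymmxP p (A : 'M[C]_p) : A \is hermsymmx <-> A^t* = A.
Proof.
split=> [/is_hermitianmxP|AE]; first by rewrite expr0 scale1r.
by apply/is_hermitianmxP; rewrite expr0 scale1r AE.
Qed.

Lemma sym_sandwichP sigma : sigma \is hermsymmx ->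
  (1%:M *t sym_proj C dB l) *m sigma *m (1%:M *t sym_proj C dB l) = sigma <->
  row_symmetric sigma.
Proof.
move=> /hermsymmxP sH; have [/hermsymmxP PH PP _] := sym_projP C dB l.
set Q := 1%:M *t sym_proj C dB l.
have QQ : Q *m Q = Q by rewrite tensmx_mul mul1mx PP.
have QH : Q^t* = Q by rewrite trmx_tens map_mxT PH trmx1 map_mx1.
rewrite -tens_sym_projP; split=> eqS; first by rewrite -[in LHS]eqS !mulmxA QQ eqS.
by rewrite eqS -[LHS]trmxCK trmx_mul map_mxM QH sH eqS sH.
Qed.

End Moments.

(** * The partial trace and the polynomial of M *)

Lemma sum_mxtens_index (V : nmodType) p q (F : 'I_(p * q) -> V) :
  \sum_u F u = \sum_i \sum_j F (mxtens_index (i, j)).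
Proof.
rewrite pair_bigA /= (reindex (@mxtens_index p q)) /=; first by apply: eq_bigr => -[].
exists (@mxtens_unindex p q) => u _; [exact: mxtens_indexK|exact: mxtens_unindexK].
Qed.

Section Target.
Local Open Scope sesquilinear_scope.
Variables (C : numClosedFieldType) (dA dB l : nat).
Let n := (dA + dB)%N.
Local Notation W := (word l.+1 dB).
Let E := (dA * #|{: W}|)%N.
Implicit Types (i k : 'I_dA) (j : 'I_dB) (r : word l dB) (sigma : 'M[C]_E)
  (M : 'M[C]_(dA * dB)).

Definition cons_word j r : W := [ffun p => oapp r j (unlift ord0 p)].

Lemma cons_word0 j r : cons_word j r ord0 = j.
Proof. by rewrite ffunE unlift_none. Qed.

Lemma cons_wordS j r p : cons_word j r (lift ord0 p) = r p.
Proof. by rewrite ffunE liftK. Qed.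

Definition tail_word (b : W) : word l dB := [ffun p => b (lift ord0 p)].

Lemma tail_wordK (b : W) : cons_word (b ord0) (tail_word b) = b.
Proof.
apply/ffunP => p; case: (unliftP ord0 p) => [q ->|->]; last by rewrite cons_word0.
by rewrite cons_wordS ffunE.
Qed.

Lemma cons_wordK j r : tail_word (cons_word j r) = r.
Proof. by apply/ffunP => p; rewrite ffunE cons_wordS. Qed.

Definition index_with_tail r (u : 'I_(dA * dB)) : 'I_E :=
  ext_index (mxtens_unindex u).1 (cons_word (mxtens_unindex u).2 r).

(** The partial trace is a sum over the common tails r of the words, each term
    being a submatrix of sigma; in particular it preserves positivity. *)
Lemma ptrace_tailE sigma :
  ptrace_tail sigma = \sum_r mxsub (index_with_tail r) (index_with_tail r) sigma.
Proof.
apply/matrixP => u v; rewrite -[u]mxtens_unindexK -[v]mxtens_unindexK summxE.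
case: (mxtens_unindex u) => i j; case: (mxtens_unindex v) => i' k.
rewrite mxE !mxtens_indexK pair_big_dep.
under [RHS]eq_bigr do rewrite mxE /index_with_tail !mxtens_indexK.
rewrite (reindex_onto (fun r => (cons_word j r, cons_word k r)) (fun bc => tail_word bc.1)) /=.
  apply: eq_bigl => r; rewrite cons_wordK eqxx andbT; apply/forallP => p.
  case: (unliftP ord0 p) => [q ->|->]; rewrite ?cons_word0 ?eqxx //.
  by rewrite lift0 /= !cons_wordS.
move=> [b c] /forallP bc /=.
have := bc ord0; rewrite /= => /andP[/eqP <- /eqP <-].
congr pair; first exact: tail_wordK.
apply/ffunP => p; case: (unliftP ord0 p) => [q ->|->]; last by rewrite cons_word0.
by rewrite cons_wordS ffunE; have := bc (lift ord0 q); rewrite lift0 => /eqP.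
Qed.

Lemma psdmx_mxsub p q (f : 'I_p -> 'I_q) (A : 'M[C]_q) : psdmx A -> psdmx (mxsub f f A).
Proof.
move=> [/hermsymmxP AH A0]; split=> [|v].
  apply/hermsymmxP/matrixP => x y; rewrite !mxE -[in RHS]AH !mxE.
  by [].
pose S : 'M[C]_(q, p) := \matrix_(x, u) (x == f u)%:R.
have colE (B : 'M[C]_q) : B *m S = colsub f B.
  apply/matrixP => x u; rewrite !mxE (bigD1 (f u)) //= mxE eqxx mulr1 big1 ?addr0 // => y yu.
  by rewrite mxE (negPf yu) mulr0.
have rowE (B : 'M[C]_(q, p)) : S^t* *m B = rowsub f B.
  apply/matrixP => u x; rewrite !mxE (bigD1 (f u)) //= !mxE eqxx conjC_nat mul1r.
  rewrite big1 ?addr0 // => y yu.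
  by rewrite !mxE (negPf yu) conjC_nat mul0r.
have -> : mxsub f f A = S^t* *m (A *m S) by rewrite colE rowE; apply/matrixP => x y; rewrite !mxE.
by have := A0 (S *m v); rewrite trmx_mul map_mxM !mulmxA.
Qed.

Lemma psdmx_sum p (I : finType) (A : I -> 'M[C]_p) :
  (forall t, psdmx (A t)) -> psdmx (\sum_t A t).
Proof.
move=> A0; split=> [|v].
  apply/hermsymmxP; rewrite linear_sum map_mx_sum; apply: eq_bigr => i _.
  by apply/hermsymmxP; case: (A0 i).
rewrite mulmx_sumr mulmx_suml summxE sumr_ge0 // => i _.
by case: (A0 i).
Qed.

Lemma psdmx_ptrace sigma : psdmx sigma -> psdmx (ptrace_tail sigma).
Proof. by move=> s0; rewrite ptrace_tailE; apply: psdmx_sum => r; apply: psdmx_mxsub. Qed.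

Lemma mpolyX_half i (b : W) :
  'X_[half_mnm 0 i b] = Xx i * \prod_p Xy (b p) :> {mpoly C[n + n]}.
Proof. by rewrite mpolyXD /= -mprodXE. Qed.

Lemma mpolyX_conj_half i (b : W) :
  'X_[conj_mnm (half_mnm 0 i b)] = Xxbar i * \prod_p Xybar (b p) :> {mpoly C[n + n]}.
Proof. by rewrite conj_half_mnm mpolyXD /= -mprodXE. Qed.

Lemma mpolyX_full_cons i j k j' r :
  'X_[full_mnm i (cons_word j r) k (cons_word j' r)] =
  (\prod_p (Xy (r p) * Xybar (r p))) * (Xx i * Xxbar k * Xy j * Xybar j')
  :> {mpoly C[n + n]}.
Proof.
rewrite mpolyXD mpolyX_half mpolyX_conj_half !big_ord_recl !cons_word0 big_split /=.
have tailE (f : 'I_dB -> {mpoly C[n + n]}) q :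
    \prod_(p < l) f (cons_word q r (lift ord0 p)) = \prod_p f (r p).
  by apply: eq_bigr => p _; rewrite cons_wordS.
rewrite !tailE; ring.
Qed.

Definition target M : {mpoly C[n + n]} := normsq_y C dA dB ^+ l * assoc_poly M.

Lemma targetE M : target M = \sum_r \sum_i \sum_j \sum_k \sum_j'
  M (mxtens_index (i, j)) (mxtens_index (k, j')) *:
    'X_[full_mnm i (cons_word j r) k (cons_word j' r)].
Proof.
rewrite /target; have -> : normsq_y C dA dB ^+ l =
      \sum_(r : word l dB) \prod_p (Xy (r p) * Xybar (r p)).
  rewrite -(bigA_distr_bigA (fun _ j => Xy j * Xybar j)) /=.
  by rewrite prodr_const card_ord.
rewrite mulr_suml; apply: eq_bigr => r _.
do 4!(rewrite mulr_sumr; apply: eq_bigr => ? _).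
by rewrite mpolyX_full_cons !scalerAr.
Qed.

(** The power of |y|^2 is the sum over all words r of y^r conj(y)^r, and r plays the
    part of the common tail of the two words in the partial trace. *)
Lemma moment_target (Phi : {scalar {mpoly C[n + n]}}) sigma M : has_moments Phi sigma ->
  Phi (target M) = \tr (M *m ptrace_tail sigma).
Proof.
move=> PhiE; rewrite targetE ptrace_tailE mulmx_sumr !raddf_sum /=.
apply: eq_bigr => r _; rewrite raddf_sum /mxtrace.
rewrite sum_mxtens_index; apply: eq_bigr => i _; rewrite raddf_sum; apply: eq_bigr => j _.
rewrite mxE sum_mxtens_index raddf_sum; apply: eq_bigr => k _; rewrite raddf_sum.
apply: eq_bigr => j' _; rewrite /= linearZ /= mxE; congr (_ * _).
rewrite /index_with_tail !mxtens_indexK /=.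
by rewrite -PhiE /full_mnm_at !ext_indexK.
Qed.

Lemma target_supp M m : (target M)@_m != 0 -> exists i (b : W) k (c : W), m = full_mnm i b k c.
Proof.
move=> m0; apply: boolp.contrapT => H; case/eqP: m0.
rewrite targetE; do 5!(rewrite raddf_sum big1 //= => ? _).
rewrite mcoeffZ mcoeffX; case: eqP => [E1|_]; last by rewrite mulr0.
by case: H; do 4!eexists; rewrite -E1.
Qed.

End Target.

(** * The functional of a symmetric extension *)

Section MomentFunctional.
Local Open Scope sesquilinear_scope.
Variables (C : numClosedFieldType) (dA dB l : nat).
Let n := (dA + dB)%N.
Local Notation W := (word l dB).
Let E := (dA * #|{: W}|)%N.
Implicit Types (u w : 'I_E) (P Q : {mpoly C[n + n]}) (s : nat).

(** Distinct pairs (u, w) may give the same monomial; dividing by their number makes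
    the functional take the value sigma w u on it.  All other monomials are sent
    to zero. *)
Definition moment_functional (sigma : 'M[C]_E) P : C :=
  \sum_u \sum_w P@_(full_mnm_at u w) *
    (sigma w u / #|[pred p : 'I_E * 'I_E | full_mnm_at p.1 p.2 == full_mnm_at u w]|%:R).

Lemma moment_functional_scalar sigma : scalar (moment_functional sigma).
Proof.
move=> a P Q; rewrite /moment_functional mulr_sumr -big_split; apply: eq_bigr => u _ /=.
rewrite mulr_sumr -big_split; apply: eq_bigr => w _ /=.
by rewrite mcoeffD mcoeffZ mulrDl -mulrA.
Qed.

HB.instance Definition _ sigma := GRing.isLinear.Build C {mpoly C[n + n]} C _
  (moment_functional sigma) (moment_functional_scalar sigma).

Lemma moment_functional_eq sigma P Q :
  (forall u w, P@_(full_mnm_at u w) = Q@_(full_mnm_at u w)) ->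
  moment_functional sigma P = moment_functional sigma Q.
Proof.
by move=> PQ; apply: eq_bigr => u _; apply: eq_bigr => w _; rewrite PQ.
Qed.

Lemma moment_functional_moments sigma :
  sigma \is hermsymmx -> row_symmetric sigma ->
  has_moments (moment_functional sigma) sigma.
Proof.
move=> /hermsymmxP sH sym u0 w0.
have fiber u w : full_mnm_at u w = full_mnm_at u0 w0 -> sigma w u = sigma w0 u0.
  move=> /full_mnm_inj[ui wi [p up] [q wq]].
  have -> : u0 = ext_index (ext_unindex u).1 [ffun x => (ext_unindex u).2 (p x)].
    by rewrite -up ui ext_unindexK.
  have -> : w0 = ext_index (ext_unindex w).1 [ffun x => (ext_unindex w).2 (q x)].
    by rewrite -wq wi ext_unindexK.
  have col x i (b : W) (r : 'S_l) : 
      sigma x (ext_index i [ffun y => b (r y)]) = sigma x (ext_index i b).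
    by rewrite -sH !mxE sym.
  by rewrite sym col !ext_unindexK.
rewrite /= /moment_functional pair_bigA /=.
under eq_bigr do rewrite mcoeffX.
pose A := [pred p : 'I_E * 'I_E | full_mnm_at p.1 p.2 == full_mnm_at u0 w0].
rewrite (bigID A) /= [X in _ + X]big1 ?addr0.
  rewrite (eq_bigr (fun=> sigma w0 u0 / #|A|%:R)).
    rewrite sumr_const -[LHS]mulr_natr divfK // pnatr_eq0 -lt0n; apply/card_gt0P.
    by exists (u0, w0); rewrite inE /= eqxx.
  by move=> [u w] /= /eqP uw; rewrite uw eqxx mul1r (fiber _ _ uw).
by move=> p /negPf uw; rewrite eq_sym uw mul0r.
Qed.

Lemma eq_mcoeffM (P Q P' Q' : {mpoly C[n + n]}) (m : 'X_{1..n + n}) :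
  (forall m1 m2, m = (m1 + m2)%MM -> P@_m1 * Q@_m2 = P'@_m1 * Q'@_m2) ->
  (P * Q)@_m = (P' * Q')@_m.
Proof.
by move=> PQ; rewrite !mcoeffM; apply: eq_bigr => -[m1 m2] /= /eqP; exact: PQ.
Qed.

(** Discards the products whose partial degrees are not those of the monomials
    x_i conj(x_k) y^b conj(y)^c. *)
Lemma moment_functional_mul0 sigma P Q (T : finType) (f : T -> 'I_(n + n)) a b :
  (forall m, P@_m != 0 -> deg_in f m = a) -> (forall m, Q@_m != 0 -> deg_in f m = b) ->
  (forall u w, deg_in f (full_mnm_at u w) != (a + b)%N) ->
  moment_functional sigma (P * Q) = 0.
Proof.
move=> Pa Qb ab; rewrite -[RHS](raddf0 (moment_functional sigma)).
apply: moment_functional_eq => u w; rewrite -(mul0r 0).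
apply: eq_mcoeffM => m1 m2 mE; rewrite !mcoeff0 mul0r.
case: (eqVneq (P@_m1) 0) => [->|/Pa m1a]; first by rewrite mul0r.
case: (eqVneq (Q@_m2) 0) => [->|/Qb m2b]; first by rewrite mulr0.
by have := ab u w; rewrite mE deg_inD m1a m2b eqxx.
Qed.

(** Several indices u may give the same monomial; they share its coefficient
    equally. *)
Lemma word_part P s : exists v : 'cV[C]_E, forall m,
  ((exists u : 'I_E, m = half_mnm_at s u) -> (word_poly s v)@_m = P@_m) /\
  ((forall u : 'I_E, m <> half_mnm_at s u) -> (word_poly s v)@_m = 0).
Proof.
pose c (u : 'I_E) :=
  P@_(half_mnm_at s u) / #|[pred u' : 'I_E | half_mnm_at s u' == half_mnm_at s u]|%:R.
exists (\col_u c u) => m.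
have coefE : (word_poly s (\col_u c u))@_m = \sum_(u : 'I_E | half_mnm_at s u == m) c u.
  rewrite /word_poly raddf_sum [RHS]big_mkcond; apply: eq_bigr => u _ /=.
  by rewrite mcoeffZ mcoeffX mxE; case: eqP; rewrite ?mulr1 ?mulr0.
rewrite coefE; split=> [[u0 ->]|mu]; last first.
  by rewrite big1 // => u /eqP um; case: (mu u).
rewrite (eq_bigr (fun=> c u0)) => [|u /eqP uu0]; last by rewrite /c uu0.
rewrite sumr_const -[LHS]mulr_natr divfK // pnatr_eq0 -lt0n; apply/card_gt0P.
by exists u0; rewrite inE /= eqxx.
Qed.

Lemma halfP (j0 : 'I_dB) s m : (s <= l)%N ->
  deg_in (@vx dA dB) m = 1%N -> deg_in (@vxbar dA dB) m = 0%N ->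
  deg_in (@vy dA dB) m = (l - s)%N -> deg_in (@vybar dA dB) m = s ->
  exists u : 'I_E, m = half_mnm_at s u.
Proof.
move=> sl mx mxb my myb; have [i [b ->]] := half_mnm_exists j0 sl mx mxb my myb.
by exists (ext_index i b); rewrite /half_mnm_at ext_indexK.
Qed.

Definition holomorphic (q : {mpoly C[n]}) : {mpoly C[n + n]} :=
  q \mPo [tuple 'X_(lshift n i) | i < n].

Lemma heval_holomorphic q z : heval (holomorphic q) z = q.@[fun t => z t 0].
Proof.
rewrite /heval comp_mpoly_meval; apply: meval_eq => t.
by rewrite tnth_mktuple mevalXU col_mxEu.
Qed.

Lemma holomorphic_supp q m : (holomorphic q)@_m != 0 -> forall i, m (rshift n i) = 0%N.
Proof.
move=> qm i; apply/eqP; apply: contraNT qm => mi; apply/eqP.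
rewrite /holomorphic comp_mpolyEX raddf_sum big1 //= => m' _.
rewrite comp_mpolyX mcoeffZ.
under eq_bigr do rewrite tnth_mktuple mpolyXn.
rewrite mprodXE mcoeffX; case: eqP => [mE|]; last by rewrite mulr0.
case/eqP: mi; rewrite -mE mnm_sumE big1 // => j _.
by rewrite mulmnE mnm1E eq_lrshift.
Qed.

(** A product of a holomorphic and an antiholomorphic monomial equal to
    x_i conj(x_k) y^b conj(y)^c has factors x_i y^b and conj(x_k y^c); so only the
    part of q carried by the monomials x_i y^b contributes. *)
Lemma moment_holomorphic_ge0 (j0 : 'I_dB) sigma q :
  psdmx sigma -> row_symmetric sigma ->
  0 <= moment_functional sigma (holomorphic q * conj_mpoly (holomorphic q)).
Proof.
move=> [sH s0] sym; have [v vE] := word_part (holomorphic q) 0.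
set g := holomorphic q; rewrite -/g in vE.
have v0 m : g@_m = 0 -> (word_poly 0 v)@_m = 0.
  move=> gm; case: (boolp.pselect (exists u : 'I_E, m = half_mnm_at 0 u)) => [/(vE m).1 ->//|mu].
  by apply: (vE m).2 => u mE; apply: mu; exists u.
rewrite (@moment_functional_eq sigma _ (word_poly 0 v * conj_mpoly (word_poly 0 v))).
  rewrite (moment_word_poly _ _ _ (moment_functional_moments sH sym)) ptranspose0.
  exact: s0.
move=> u w; apply: eq_mcoeffM => m1 m2 mE; rewrite !mcoeff_conj.
case: (eqVneq (g@_m1) 0) => [g1|g1]; first by rewrite (v0 _ g1) g1 !mul0r.
case: (eqVneq (g@_(conj_mnm m2)) 0) => [g2|g2].
  by rewrite (v0 _ g2) g2 conjC0 !mulr0.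
have bar0 (T : finType) (f : T -> 'I_n) m : g@_m != 0 ->
    deg_in (fun t => rshift n (f t)) m = 0%N.
  by move=> gm; apply: big1 => t _; rewrite (holomorphic_supp gm).
have {bar0} bar0 m : g@_m != 0 ->
    deg_in (@vxbar dA dB) m = 0%N /\ deg_in (@vybar dA dB) m = 0%N.
  by move=> gm; split; exact: bar0.
have [x1 y1] := bar0 _ g1; have [x2 y2] := bar0 _ g2.
have [dx dxb dy dyb] := deg_full_at u w.
have [ex exb ey eyb] := conj_mnm_deg m2.
rewrite exb in x2; rewrite eyb in y2.
rewrite mE !deg_inD in dx dxb dy dyb.
rewrite (vE m1).1; last by apply: (halfP j0) => //; lia.
by rewrite (vE (conj_mnm m2)).1 //; apply: (halfP j0); rewrite ?ex ?exb ?ey ?eyb; lia.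
Qed.

End MomentFunctional.

Section Squares.
Local Open Scope sesquilinear_scope.
Variables (C : numClosedFieldType) (dA dB l : nat).
Let n := (dA + dB)%N.
Local Notation W := (word l dB).
Let E := (dA * #|{: W}|)%N.

Lemma word_poly_supp s (v : 'cV[C]_E) m : (word_poly s v)@_m != 0 ->
  exists u : 'I_E, m = half_mnm_at s u.
Proof.
move=> m0; apply: boolp.contrapT => H; case/eqP: m0.
rewrite /word_poly raddf_sum big1 //= => u _.
rewrite mcoeffZ mcoeffX; case: eqP => [um|_]; last by rewrite mulr0.
by case: H; exists u.
Qed.

Definition x_weight (m : 'X_{1..n + n}) : nat :=
  (deg_in (@vx dA dB) m + deg_in (@vxbar dA dB) m)%N.
Definition y_weight (m : 'X_{1..n + n}) : nat :=
  (deg_in (@vy dA dB) m + deg_in (@vybar dA dB) m)%N.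

(** The monomials of G contain either one x or one conj(x), and the reality of G
    exchanges the two halves by conjugation.  The half with x is split
    according to the number s of factors conj(y). *)
Lemma hermitian_words (j0 : 'I_dB) (G : {mpoly C[n + n]}) :
  hermitian_poly G ->
  (forall m, G@_m != 0 -> x_weight m = 1%N /\ y_weight m = l) ->
  exists v : 'I_l.+1 -> 'cV[C]_E,
    G = \sum_(s < l.+1) word_poly s (v s) + conj_mpoly (\sum_(s < l.+1) word_poly s (v s)).
Proof.
move=> /hermitianP GH Gwt.
have [v vE] : exists v : 'I_l.+1 -> 'cV[C]_E, forall (s : 'I_l.+1) m,
    ((exists u : 'I_E, m = half_mnm_at s u) -> (word_poly s (v s))@_m = G@_m) /\
    ((forall u : 'I_E, m <> half_mnm_at s u) -> (word_poly s (v s))@_m = 0).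
  have [v vE] := boolp.choice (fun s : 'I_l.+1 => word_part l G s).
  by exists v => s m; exact: vE.
exists v; set h := \sum_(s < l.+1) _.
have hE m : h@_m = G@_m *+ (deg_in (@vx dA dB) m == 1%N).
  case: (eqVneq (G@_m) 0) => [G0|G0].
    rewrite G0 mul0rn /h raddf_sum big1 //= => s _; apply/eqP; apply: contraT => w0.
    by have := (vE s m).1 (word_poly_supp w0); rewrite G0 => E0; rewrite E0 eqxx in w0.
  have [xw yw] := Gwt m G0; rewrite /x_weight /y_weight in xw yw.
  case: eqP => [x1|x0].
    have sl : (deg_in (@vybar dA dB) m < l.+1)%N by lia.
    rewrite mulr1n /h raddf_sum (bigD1 (Ordinal sl)) //= big1 ?addr0 => [|s ss].
      by apply: (vE (Ordinal sl) m).1; apply: (halfP j0) => //=; lia.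
    apply/eqP; apply: contraT => /word_poly_supp[u mE].
    case/eqP: ss; apply: val_inj => /=.
    by have [_ _ _ <-] := half_mnm_at_deg u (leq_ord s); rewrite mE.
  rewrite mulr0n /h raddf_sum big1 //= => s _; apply/eqP; apply: contraT.
  move=> /word_poly_supp[u mE]; case: x0.
  by rewrite mE; case: (half_mnm_at_deg u (leq_ord s)).
apply/mpolyP => m; rewrite mcoeffD mcoeff_conj !hE rmorphMn /=.
rewrite -mcoeff_conj GH; have [-> _ _ _] := conj_mnm_deg m.
case: (eqVneq (G@_m) 0) => [->|G0]; first by rewrite !mul0rn addr0.
have [xw _] := Gwt m G0; rewrite /x_weight in xw.
case: (eqVneq (deg_in (@vx dA dB) m) 1%N) => x1.
  by rewrite (_ : deg_in (@vxbar dA dB) m = 0%N) ?addr0 //; lia.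
by rewrite (_ : deg_in (@vxbar dA dB) m = 1%N) ?add0r //; lia.
Qed.

(** With G = h + conj h, the degrees in conj x (resp. x) kill h^2 (resp. its
    conjugate), and the degree in conj y kills the products of the parts of h and
    conj h that belong to different s. *)
Lemma moment_square_ge0 (j0 : 'I_dB) (sigma : 'M[C]_E) (G : {mpoly C[n + n]}) :
  (forall s, (s <= l)%N -> psdmx (ptranspose s sigma)) -> row_symmetric sigma ->
  hermitian_poly G ->
  (forall m, G@_m != 0 -> x_weight m = 1%N /\ y_weight m = l) ->
  0 <= moment_functional sigma (G ^+ 2).
Proof.
move=> ppt sym GH Gwt; have [v ->] := hermitian_words j0 GH Gwt.
have sH : sigma \is hermsymmx by have [] := ppt 0%N isT; rewrite ptranspose0.
set h := \sum_(s < l.+1) _.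
have h_deg m : h@_m != 0 -> deg_in (@vx dA dB) m = 1%N /\ deg_in (@vxbar dA dB) m = 0%N.
  move=> h0; have [s w0] : exists s : 'I_l.+1, (word_poly s (v s))@_m != 0.
    apply/existsP; apply: contraNT h0 => /existsPn w0.
    by rewrite /h raddf_sum big1 //= => s _; apply/eqP; rewrite -[_ == _]negbK w0.
  have [u ->] := word_poly_supp w0.
  by have [-> -> _ _] := half_mnm_at_deg u (leq_ord s).
have hb_deg m : (conj_mpoly h)@_m != 0 -> deg_in (@vxbar dA dB) m = 1%N.
  rewrite mcoeff_conj conjC_eq0 => /h_deg[<- _]; by have [] := conj_mnm_deg m.
have hb_deg' m : (conj_mpoly h)@_m != 0 -> deg_in (@vx dA dB) m = 0%N.
  rewrite mcoeff_conj conjC_eq0 => /h_deg[_ <-]; by have [] := conj_mnm_deg m.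
have hh : moment_functional sigma (h * h) = 0.
  apply: (@moment_functional_mul0 _ _ _ _ _ _ _ _ (@vxbar dA dB) 0 0).
  - by move=> m /h_deg[].
  - by move=> m /h_deg[].
  - by move=> u w; have [_ -> _ _] := deg_full_at u w.
have hbhb : moment_functional sigma (conj_mpoly h * conj_mpoly h) = 0.
  apply: (@moment_functional_mul0 _ _ _ _ _ _ _ _ (@vx dA dB) 0 0) => //.
  by move=> u w; have [-> _ _ _] := deg_full_at u w.
suff cross : 0 <= moment_functional sigma (h * conj_mpoly h).
  have -> : (h + conj_mpoly h) ^+ 2 =
      h * h + (h * conj_mpoly h + h * conj_mpoly h) + conj_mpoly h * conj_mpoly h by ring.
  by rewrite !raddfD /= hh hbhb add0r addr0 addr_ge0.
rewrite /h conj_mpoly_sum mulr_suml raddf_sum sumr_ge0 // => s _.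
rewrite mulr_sumr raddf_sum (bigD1 s) //= big1 ?addr0 => [|s' s's]; last first.
  apply: (@moment_functional_mul0 _ _ _ _ _ _ _ _ (@vybar dA dB) s (l - s')%N).
  - move=> m /word_poly_supp[u ->].
    by have [_ _ _ ->] := half_mnm_at_deg u (leq_ord s).
  - move=> m; rewrite mcoeff_conj conjC_eq0 => /word_poly_supp[u mE].
    have [_ _ <- _] := conj_mnm_deg m; rewrite mE.
    by have [_ _ -> _] := half_mnm_at_deg u (leq_ord s').
  - move=> u w; have [_ _ _ ->] := deg_full_at u w.
    by case: s s' s's => s sl [s' s'l] /=; rewrite -val_eqE /=; lia.
rewrite (moment_word_poly _ _ _ (moment_functional_moments sH sym)).
by have [_] := ppt s (leq_ord s); apply.
Qed.

End Squares.

(** * From sums of squares to the dual cones *)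

Section SosToDual.
Local Open Scope sesquilinear_scope.
Variables (C : numClosedFieldType) (dA dB l : nat).
Let n := (dA + dB)%N.
Hypothesis dB0 : (0 < dB)%N.
Implicit Types (M : 'M[C]_(dA * dB)).

Lemma csos_dual M : M \is hermsymmx -> csos (target l M) -> dual_cone (EXT C dA dB l.+1) M.
Proof.
move=> MH [qs qsE]; split=> // rho [_ [sigma [s0 <- sS]]].
have sH : sigma \is hermsymmx by case: s0.
have sym : row_symmetric sigma by apply/sym_sandwichP.
rewrite -(moment_target M (moment_functional_moments sH sym)).
have -> : target l M = \sum_(q <- qs) holomorphic q * conj_mpoly (holomorphic q).
  apply: heval_inj => z; rewrite qsE heval_sum.
  by apply: eq_bigr => q _; rewrite -heval_holomorphic -conj_sqr.
rewrite raddf_sum sumr_ge0 // => q _.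
exact: (moment_holomorphic_ge0 (Ordinal dB0)).
Qed.

(** Homogenise first in x, with weight 1, and then in y, with weight l + 1. *)
Lemma rsos_dual M : M \is hermsymmx -> rsos (target l M) -> dual_cone (DPS C dA dB l.+1) M.
Proof.
move=> MH [gs [gsH gsE]]; split=> // rho [_ [sigma [[s0 <- sS] ppt]]].
have sH : sigma \is hermsymmx by case: s0.
have sym : row_symmetric sigma by apply/sym_sandwichP.
rewrite -(moment_target M (moment_functional_moments sH sym)).
have tE : target l M = \sum_(g <- gs) g ^+ 2.
  apply: heval_inj => z; rewrite gsE heval_sum.
  by apply: eq_bigr => g _; rewrite /heval rmorphXn.
have supp m : (target l M)@_m != 0 ->
    x_weight m = 1.*2 /\ y_weight m = l.+1.*2.
  move=> /target_supp[i [b [k [c ->]]]].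
  have [dx dxb dy dyb] := deg_full i b k c.
  by rewrite /x_weight /y_weight dx dxb dy dyb !addnn.
have xD m1 m2 : @x_weight dA dB (m1 + m2)%MM = (x_weight m1 + x_weight m2)%N.
  by rewrite /x_weight !deg_inD; lia.
have yD m1 m2 : @y_weight dA dB (m1 + m2)%MM = (y_weight m1 + y_weight m2)%N.
  by rewrite /y_weight !deg_inD; lia.
have xC m : @x_weight dA dB (conj_mnm m) = x_weight m.
  by rewrite /x_weight; have [-> -> _ _] := conj_mnm_deg m; rewrite addnC.
have yC m : @y_weight dA dB (conj_mnm m) = y_weight m.
  by rewrite /y_weight; have [_ _ -> ->] := conj_mnm_deg m; rewrite addnC.
pose hs := map (homog_part (@x_weight dA dB) 1) gs.
have hsH h : h \in hs -> hermitian_poly h.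
  by move=> /mapP[g gg ->]; apply: hermitian_homog_part => //; exact: gsH.
have hE : target l M = \sum_(h <- hs) h ^+ 2.
  by rewrite big_map; apply: (homog_sos xD xC gsH _ tE) => m /supp[].
have -> : target l M = \sum_(h <- hs) (homog_part (@y_weight dA dB) l.+1 h) ^+ 2.
  by apply: (homog_sos yD yC hsH _ hE) => m /supp[].
rewrite raddf_sum big_seq sumr_ge0 //= => h hh.
apply: (moment_square_ge0 (Ordinal dB0)) => //.
- by case=> [|s] sl; [rewrite ptranspose0|apply: ppt].
- by apply: hermitian_homog_part => //; exact: hsH.
move=> m; rewrite mcoeff_homog_part; case/mapP: hh => g _ ->; rewrite mcoeff_homog_part.
case: (y_weight m =P l.+1) => [->|_]; last by rewrite mulr0n eqxx.
by case: (x_weight m =P 1%N) => [->//|_]; rewrite mulr0n mul0rn eqxx.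
Qed.

End SosToDual.

(** * Separable states *)

Section Separable.
Local Open Scope sesquilinear_scope.
Variables (C : numClosedFieldType) (dA dB : nat).
Implicit Types (M : 'M[C]_(dA * dB)) (x : 'cV[C]_dA) (y : 'cV[C]_dB).

Lemma trace_product_state M x y :
  \tr (M *m ((x *m x^t*) *t (y *m y^t*))) =
  heval (assoc_poly M) (col_mx (map_mx Num.conj x) (map_mx Num.conj y)).
Proof.
rewrite heval_assoc_poly /mxtrace sum_mxtens_index.
apply: eq_bigr => i _; apply: eq_bigr => j _; rewrite mxE sum_mxtens_index.
apply: eq_bigr => k _; apply: eq_bigr => j' _.
rewrite tensmxE !mxE !big_ord1 !mxE !conjCK; ring.
Qed.

Lemma conj_mxK p q (A : 'M[C]_(p, q)) : map_mx Num.conj (map_mx Num.conj A) = A.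
Proof. by apply/matrixP => u v; rewrite !mxE conjCK. Qed.

Lemma SEP_dual : dual_cone (SEP C dA dB) =
  [set M | M \is hermsymmx /\ nonneg_poly (assoc_poly M)].
Proof.
apply/seteqP; split=> M [MH Mpos]; split=> //.
  move=> z; rewrite -[z]vsubmxK -[usubmx z]conj_mxK -[dsubmx z]conj_mxK.
  rewrite -trace_product_state; apply: Mpos.
  exists 1%N, (fun=> 1), (fun=> map_mx Num.conj (usubmx z)),
    (fun=> map_mx Num.conj (dsubmx z)).
  by split=> [_|]; rewrite ?ler01 // big_ord1 scale1r.
move=> rho [m [p [x [y [p0 ->]]]]].
rewrite mulmx_sumr raddf_sum sumr_ge0 // => i _.
by rewrite -scalemxAr /= mxtraceZ mulr_ge0 // trace_product_state.
Qed.

Lemma assoc_poly_real M : M \is hermsymmx -> hermitian_poly (assoc_poly M).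
Proof.
move=> /hermsymmxP MH z; rewrite -[z]vsubmxK heval_assoc_poly; apply/CrealP.
move: (usubmx z) (dsubmx z) => x y.
pose F (p q : 'I_dA * 'I_dB) := M (mxtens_index p) (mxtens_index q) *
  (x p.1 0 * (x q.1 0)^* * y p.2 0 * (y q.2 0)^*).
have -> : \sum_(i < dA) \sum_(j < dB) \sum_(k < dA) \sum_(l < dB)
    M (mxtens_index (i, j)) (mxtens_index (k, l))
      * (x i 0 * (x k 0)^* * y j 0 * (y l 0)^*) = \sum_p \sum_q F p q.
  rewrite pair_bigA /=; apply: eq_bigr => -[i j] _; rewrite pair_bigA /=.
  by apply: eq_bigr => -[].
rewrite rmorph_sum exchange_big /=; apply: eq_bigr => p _.
rewrite rmorph_sum; apply: eq_bigr => q _ /=.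
rewrite /F !rmorphM /= !conjCK -{1}MH !mxE conjCK; ring.
Qed.

End Separable.

(** * From the dual cones to sums of squares *)

Section Evaluation.
Local Open Scope sesquilinear_scope.
Variables (C : numClosedFieldType) (dA dB l : nat).
Let n := (dA + dB)%N.
Local Notation W := (word l dB).
Let E := (dA * #|{: W}|)%N.

Definition signed_evaluation m (t : 'I_m -> 'cV[C]_n) (L : 'I_m -> C)
  (P : {mpoly C[n + n]}) : C := \sum_j L j * heval P (t j).

Lemma signed_evaluation_scalar m (t : 'I_m -> 'cV[C]_n) L :
  scalar (signed_evaluation t L).
Proof.
move=> a P Q; rewrite /signed_evaluation mulr_sumr -big_split; apply: eq_bigr => j _ /=.
by rewrite /heval mevalD mevalZ mulrDr mulrCA.
Qed.

HB.instance Definition _ m (t : 'I_m -> 'cV[C]_n) L :=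
  GRing.isLinear.Build C {mpoly C[n + n]} C _
    (signed_evaluation t L) (signed_evaluation_scalar t L).

(** Makes the moment matrix of a real functional Hermitian. *)
Lemma conj_full_mnm (i : 'I_dA) (b : W) (k : 'I_dA) (c : W) :
  conj_mnm (full_mnm i b k c) = full_mnm k c i b.
Proof. by rewrite /full_mnm conj_mnmD conj_mnmK addmC. Qed.

Lemma full_mnm_permr (i : 'I_dA) (b : W) (k : 'I_dA) (c : W) (s : 'S_l) :
  full_mnm i b k [ffun p => c (s p)] = full_mnm i b k c.
Proof.
apply/mnmP => v; case: (varP v) => -[u ->]; rewrite !full_mnmE //.
rewrite [RHS](reindex_inj (@perm_inj _ s)).
by apply: eq_bigr => p _; rewrite ffunE.
Qed.

Lemma hermsymmx_ptranspose s (sigma : 'M[C]_E) :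
  sigma \is hermsymmx -> ptranspose s sigma \is hermsymmx.
Proof.
move=> /hermsymmxP sH; apply/hermsymmxP/matrixP => u w.
rewrite [LHS]mxE [in LHS]mxE !ptransposeE -[in RHS]sH; symmetry.
by rewrite [LHS]mxE [in LHS]mxE.
Qed.

Lemma heval_word_poly s (v : 'cV[C]_E) z :
  heval (word_poly s v) z = \sum_u v u 0 * heval 'X_[half_mnm_at s u] z.
Proof.
rewrite /heval /word_poly raddf_sum; apply: eq_bigr => u _; exact: mevalZ.
Qed.

Section SignedMoments.
Variables (m : nat) (t : 'I_m -> 'cV[C]_n) (L : 'I_m -> C).
Hypothesis L_real : forall j, L j \is Num.real.

Definition signed_moments : 'M[C]_E :=
  \matrix_(w, u) signed_evaluation t L 'X_[full_mnm_at u w].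

Lemma signed_momentsP : has_moments (signed_evaluation t L) signed_moments.
Proof. by move=> u w; rewrite mxE. Qed.

Lemma signed_moments_herm : signed_moments \is hermsymmx.
Proof.
apply/hermsymmxP/matrixP => w u; rewrite !mxE /signed_evaluation rmorph_sum.
apply: eq_bigr => j _; rewrite rmorphM /= (CrealP (L_real j)) -heval_conj conj_mpolyX.
by rewrite conj_full_mnm.
Qed.

Lemma signed_moments_sym : row_symmetric signed_moments.
Proof. by move=> s i b u; rewrite !mxE /full_mnm_at !ext_indexK /= full_mnm_permr. Qed.

Lemma signed_moments_psd s :
  (forall v : 'cV[C]_E, 0 <= \sum_j L j * `|heval (word_poly s v) (t j)| ^+ 2) ->
  psdmx (ptranspose s signed_moments).
Proof.
move=> L0; split=> [|v]; first exact/hermsymmx_ptranspose/signed_moments_herm.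
rewrite -(moment_word_poly _ _ _ signed_momentsP) /= /signed_evaluation.
by under eq_bigr do rewrite conj_sqr.
Qed.

End SignedMoments.
End Evaluation.

Section DualToSos.
Local Open Scope sesquilinear_scope.
Variables (R : realType) (dA dB l : nat).
Let n := (dA + dB)%N.
Local Notation W := (word l.+1 dB).
Let E := (dA * #|{: W}|)%N.

Lemma target_real (M : 'M[R[i]]_(dA * dB)) : M \is hermsymmx -> hermitian_poly (target l M).
Proof.
move=> MH z; rewrite /target /heval mevalM rmorphXn /=.
apply: rpredM; last exact: assoc_poly_real.
apply: rpredX; rewrite -/(heval _ _) -[z]vsubmxK heval_normsq_y.
by apply: rpred_sum => j _; rewrite -normCK rpredX // normr_real.
Qed.

(** EXT is the case k = 0 and DPS the case k = l + 1.  The duality is applied to the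
    family of all monomials [half_mnm_at s u] with s <= k. *)
Lemma dual_sos k (K : set 'M[R[i]]_(dA * dB)) M :
  (forall rho (sigma : 'M[R[i]]_E), psdmx rho -> is_sym_extension rho sigma ->
     (forall s, (s < k.+1)%N -> psdmx (ptranspose s sigma)) -> K rho) ->
  dual_cone K M ->
  exists N (c : 'I_N -> 'I_k.+1 -> 'cV[R[i]]_E), forall z,
    heval (target l M) z =
      \sum_i `|heval (\sum_(s < k.+1) word_poly s (c i s)) z| ^+ 2.
Proof.
move=> KP [MH Mpos].
pose I : finType := ('I_k.+1 * 'I_E)%type.
pose b (z : 'cV[R[i]]_n) : 'cV[R[i]]_#|I| :=
  \col_e (let p : I := enum_val e in heval 'X_[half_mnm_at p.1 p.2] z).
pose row_of (v : 'I_k.+1 -> 'cV[R[i]]_E) : 'rV[R[i]]_#|I| :=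
  \row_e (let p : I := enum_val e in v p.1 p.2 0).
have bE (v : 'I_k.+1 -> 'cV[R[i]]_E) z :
    (row_of v *m b z) 0 0 =
    heval (\sum_(s < k.+1) word_poly s (v s)) z.
  rewrite /heval raddf_sum mxE (reindex (@enum_rank I)) /=; last first.
    by exists enum_val => e _; [exact: enum_rankK|exact: enum_valK].
  pose G (s : 'I_k.+1) (u : 'I_E) := v s u 0 * heval 'X_[half_mnm_at s u] z.
  rewrite (eq_bigr (fun e : I => G e.1 e.2)) => [|e _]; last first.
    by rewrite !mxE enum_rankK.
  rewrite -(pair_bigA _ G) /=.
  by apply: eq_bigr => s _; rewrite -heval_word_poly.
have [|N [c cE]] := sos_duality (b := b) (F := fun z => complex.Re (heval (target l M) z)).
  move=> m t L Lpos.
  pose LC j : R[i] := (L j)%:C%C.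
  have LR j : LC j \is Num.real by apply/complex_realP; exists (L j).
  pose sigma : 'M[R[i]]_E := signed_moments l.+1 t LC.
  have ppt s : (s < k.+1)%N -> psdmx (ptranspose s sigma).
    move=> sk; apply: signed_moments_psd => // v.
    (* The form of the s-th partial transpose is tested by combinations of the s-th block. *)
    pose v' (s' : 'I_k.+1) := if s' == Ordinal sk then v else 0.
    have v'E z : heval (\sum_(s' < k.+1) word_poly s' (v' s')) z = heval (word_poly s v) z.
      rewrite heval_sum (bigD1 (Ordinal sk)) //= /v' eqxx big1 ?addr0 // => s' /negPf->.
      by rewrite heval_word_poly big1 // => u _; rewrite mxE mul0r.
    have := Lpos (row_of v').
    rewrite -ler0c rmorph_sum /=; congr (0 <= _); apply: eq_bigr => j _.
    by rewrite rmorphM /= sqmodE bE v'E -normCK.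
  have s0 : psdmx sigma by rewrite -(ptranspose0 sigma); exact: ppt.
  have ext : is_sym_extension (ptrace_tail sigma) sigma.
    split=> //; apply/sym_sandwichP; first by case: s0.
    exact: signed_moments_sym.
  have := Mpos _ (KP _ _ (psdmx_ptrace s0) ext ppt).
  rewrite -(moment_target M (@signed_momentsP _ _ _ l.+1 _ t LC)) /= /signed_evaluation.
  rewrite -ler0c rmorph_sum /=; congr (0 <= _); apply: eq_bigr => j _.
  by rewrite rmorphM /= RRe_real // target_real.
exists N, (fun i s => \col_u c i 0 (enum_rank ((s, u) : I))) => z.
rewrite -[LHS]RRe_real ?target_real // cE rmorph_sum; apply: eq_bigr => i _ /=.
rewrite sqmodE -normCK -bE; congr (`|(_ *m _) 0 0| ^+ 2).
by apply/rowP => e; rewrite [RHS]mxE [RHS]mxE -surjective_pairing enum_valK.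
Qed.

Lemma DPS_dual_rsos M : dual_cone (DPS R[i] dA dB l.+1) M -> rsos (target l M).
Proof.
move=> Mdual; have [] := @dual_sos l.+1 (DPS R[i] dA dB l.+1) M _ Mdual.
  move=> rho sigma rho0 ext ppt; split=> //; exists sigma; split=> // s /andP[_ sl].
  by apply: ppt; rewrite ltnS.
move=> N [c cE]; pose h i := \sum_(s < l.+2) word_poly s (c i s).
(* A squared modulus is the sum of the squares of the real and imaginary parts. *)
pose re i := 2^-1 *: (h i + conj_mpoly (h i)).
pose im i := (2 * 'i)^-1 *: (h i - conj_mpoly (h i)).
have reE i z : heval (re i) z = 'Re (heval (h i) z).
  by rewrite /heval mevalZ mevalD -!/(heval _ z) heval_conj ReE mulrC.
have imE i z : heval (im i) z = 'Im (heval (h i) z).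
  rewrite /heval mevalZ mevalB -!/(heval _ z) heval_conj ImE.
  by rewrite invfM invCi; ring.
exists (map re (index_enum 'I_N) ++ map im (index_enum 'I_N)); split=> [g|z].
  rewrite mem_cat => /orP[] /mapP[i _ ->] z; rewrite ?reE ?imE; exact: Creal_Re || exact: Creal_Im.
rewrite cE big_cat /= !big_map -big_split; apply: eq_bigr => i _ /=.
by rewrite reE imE -normC2_Re_Im.
Qed.

Lemma EXT_dual_csos M : dual_cone (EXT R[i] dA dB l.+1) M -> csos (target l M).
Proof.
move=> Mdual; have [] := @dual_sos 0 (EXT R[i] dA dB l.+1) M _ Mdual.
  by move=> rho sigma rho0 ext _; split=> //; exists sigma.
move=> N [c cE].
pose q i : {mpoly R[i][n]} := \sum_(u : 'I_E) c i 0 u 0 *: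
  ('X_(lshift dB (ext_unindex u).1) * \prod_p 'X_(rshift dA ((ext_unindex u).2 p))).
exists (map q (index_enum 'I_N)) => z; rewrite cE big_map; apply: eq_bigr => i _ /=.
rewrite big_ord1 heval_word_poly /q raddf_sum; congr (`|_| ^+ 2).
apply: eq_bigr => u _ /=; rewrite mevalZ; congr (_ * _).
rewrite /half_mnm_at mpolyX_half /heval !mevalM !mevalXU col_mxEu !rmorph_prod; congr (_ * _).
by apply: eq_bigr => p _ /=; rewrite !mevalXU col_mxEu.
Qed.

End DualToSos.

Unset Implicit Arguments.

Theorem theorem12 (R : realType) (dA dB l : nat)
  (hA : (1 <= dA)%N) (hB : (1 <= dB)%N) (hl : (1 <= l)%N) :
  [/\ dual_cone (SEP R[i] dA dB) =
        [set M : 'M[R[i]]_(dA * dB) |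
          M \is hermsymmx /\ nonneg_poly (assoc_poly M)],
      dual_cone (DPS R[i] dA dB l) =
        [set M : 'M[R[i]]_(dA * dB) |
          M \is hermsymmx /\
          rsos (normsq_y R[i] dA dB ^+ (l - 1) * assoc_poly M)] &
      dual_cone (EXT R[i] dA dB l) =
        [set M : 'M[R[i]]_(dA * dB) |
          M \is hermsymmx /\
          csos (normsq_y R[i] dA dB ^+ (l - 1) * assoc_poly M)]].
Proof.
case: l hl => [//|l] _; rewrite subn1; split; first exact: SEP_dual.
- apply/seteqP; split=> M; first by move=> Md; split; [case: Md|exact: DPS_dual_rsos].
  by case=> MH; exact: rsos_dual.
- apply/seteqP; split=> M; first by move=> Md; split; [case: Md|exact: EXT_dual_csos].
  by case=> MH; exact: csos_dual.
Qed.
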